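(* Let $\varepsilon > 0$ and an integer $k \geq 2$ be fixed, and let $C$ be an orientation of a $k$-cycle. Then there exists a constant $c \geq 1$ such that every digraph $D$ without loops or parallel arcs with $\chi(D) \geq c$ and minimum out-degree at least $\varepsilon|V(D)|$ contains $C$ as a subdigraph, if and only if $C$ either consists of at least three blocks or consists of exactly two blocks, both of length at least two.
   Context: Digraphs have no loops and no parallel arcs, but anti-parallel arcs (directed 2-cycles) are allowed. An orientation of an undirected graph $G$ is a digraph on $V(G)$ containing, for each edge $uv\in E(G)$, exactly one of the arcs $uv$, $vu$. The chromatic number $\chi(D)$ of a digraph is the chromatic number of its underlying undirected graph. Subdigraphs need not be induced. A block of an orientation $C$ of a cycle is a maximal connected subdigraph of $C$ that contains neither the oriented path $x\rightarrow y\leftarrow z$ nor the oriented path $x\leftarrow y\rightarrow z$ as a subdigraph (so a directed cycle has one block, and otherwise the blocks are the maximal directed subpaths). The length of a block $B$ is $|E(B)|$.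
   Formalization: ε is quantified inside the equivalence: C meets the block condition iff for every ε > 0 such a c exists (so otherwise no c exists for all small ε); with ε fixed outside, the claim fails, e.g. for ε = 1 and a directed cycle, where no nonempty D qualifies. *)

(* Defs.v *)
From HB Require Import structures.
From mathcomp Require Import all_boot all_order all_algebra.
From mathcomp Require Import reals.
Set Implicit Arguments. Unset Strict Implicit. Unset Printing Implicit Defensive.

Record digraph := Digraph {
  vertex :> finType;
  arc : rel vertex;
  arc_irr : irreflexive arc }.

Arguments arc {d} : rename.

Definition colorable (T : finType) (e : rel T) (n : nat) : bool :=
  [exists f : {ffun T -> 'I_n}, forall x, forall y, e x y ==> (f x != f y)].

Definition underlying (D : digraph) : rel D := fun x y => arc x y || arc y x.

Lemma colorable_card (D : digraph) :
  exists n, colorable (@underlying D) n.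
Proof.
exists #|D|; apply/existsP; exists [ffun x => enum_rank x].
apply/forallP => x; apply/forallP => y; apply/implyP; rewrite !ffunE.
apply: contraTneq => /enum_rank_inj ->.
by rewrite /underlying orbb arc_irr.
Qed.

Definition chi (D : digraph) : nat := ex_minn (colorable_card D).

Definition outdeg (D : digraph) (x : D) : nat := #|[set y | arc x y]|.

(* Every out-degree is less than #|D|, so the default value #|D| of the minimum
   is reached only when D is empty. *)
Definition min_outdeg (D : digraph) : nat :=
  \big[minn/#|D|]_(x : D) outdeg x.

Definition contains (D C : digraph) : Prop :=
  exists2 f : C -> D, injective f & forall x y, arc x y -> arc (f x) (f y).

(* The k edges of the cycle on v 0, ..., v (k - 1) are the v i v (i + 1), indices
   modulo k; edge i is replaced by one of its two arcs, as chosen by d i. *)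
Definition cycle_arc (k : nat) (T : Type) (v : 'I_k -> T) (d : 'I_k -> bool)
    (i : 'I_k) : T * T :=
  if d i then (v i, v (ordS i)) else (v (ordS i), v i).

(* A 2-cycle has two parallel edges. Injectivity of cycle_arc is automatic for
   k >= 3; for k = 2 it says that these two edges do not yield parallel arcs, so
   the only orientation of a 2-cycle is the directed 2-cycle. *)
Definition cycle_orientation (k : nat) (C : digraph) : Prop :=
  exists (v : 'I_k -> C) (d : 'I_k -> bool),
    [/\ bijective v,
        injective (cycle_arc v d) &
        forall x y : C, arc x y <-> exists i, cycle_arc v d i = (x, y)].

Section Blocks.
Variable C : digraph.
(* A vertex set together with a set of arcs. *)
Implicit Types H K : {set C} * {set C * C}.

Definition subdigraph H : bool :=
  [forall a in H.2, [&& arc a.1 a.2, a.1 \in H.1 & a.2 \in H.1]].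

Definition connected H : bool :=
  (H.1 != set0) &&
  [forall x in H.1, forall y in H.1,
     connect (fun u w => ((u, w) \in H.2) || ((w, u) \in H.2)) x y].

(* Neither x -> y <- z nor x <- y -> z. As these are paths, x and z must be
   distinct; they differ from y because there are no loops. *)
Definition turn_free H : bool :=
  [forall x, forall y, forall z, (x != z) ==>
     ~~ (((x, y) \in H.2) && ((z, y) \in H.2)) &&
     ~~ (((y, x) \in H.2) && ((y, z) \in H.2))].

Definition block_cand H : bool := [&& subdigraph H, connected H & turn_free H].

Definition is_block H : bool :=
  block_cand H &&
  [forall K, [&& block_cand K, H.1 \subset K.1 & H.2 \subset K.2] ==> (K == H)].

Definition blocks : {set {set C} * {set C * C}} := [set H | is_block H].

Definition block_length H : nat := #|H.2|.

End Blocks.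

(* Main.v *)
From mathcomp Require Import all_boot all_order all_algebra zify.
From mathcomp Require Import boolp reals.
(* Required last because mathcomp's path.arc would otherwise shadow arc. *)
Require Import Defs.
Set Implicit Arguments. Unset Strict Implicit. Unset Printing Implicit Defensive.

(* Encode an orientation of a cycle by a word, U = true for forward edges and
   D = false for backward ones. A cycle as in the theorem has, up to rotation, a
   word w1 UD w2 UD (two sinks) or w UUDD (one sink between two blocks of length
   at least two).

   Sufficiency. A digraph of large chromatic number contains every oriented path.
   For w UUDD, a bounded sample of vertices c is such that most vertices have an
   out-neighbour in it; colouring x by some c reached by many paths x -> a -> c,
   one colour class has large chromatic number, and a path with word w in that
   class closes up through c. For w1 UD w2 UD, having few common out-neighbours is
   a graph on the vertices with bounded clique number, because out-neighbourhoods
   have linear size; this yields two disjoint paths with words w1 and w2 all of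
   whose cross pairs have many common out-neighbours, where the sinks are placed.

   Necessity. Add arcs from a shift graph on increasing (t + 1)-tuples to a blow-up
   of a long directed cycle so that vertices at distance t along the shift have
   disjoint out-neighbourhoods, with t = k - 2: such digraphs have no directed
   k-cycle and no arc parallel to a directed path of length k - 1. *)

(** * Colourings of vertex sets and degeneracy *)

(** The set [A] is explicit and the colours are natural numbers, so that the pieces of a cover can
    be coloured separately and their palettes shifted apart. The relation [e] is not symmetrized,
    since a proper colouring ignores directions. *)
Definition setcol (T : finType) (e : rel T) (A : {set T}) (c : nat) : Prop :=
  exists f : T -> nat, (forall x, x \in A -> f x < c) /\
    (forall x y, x \in A -> y \in A -> e x y -> f x != f y).

Lemma setcolS (T : finType) (e : rel T) (A B : {set T}) (a b : nat) :
  A \subset B -> b <= a -> setcol e B b -> setcol e A a.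
Proof.
move=> /subsetP sAB le_ba [f [fb fe]]; exists f; split=> [x /sAB /fb|x y xA yA].
  by move=> /leq_trans; apply.
by apply: fe; apply: sAB.
Qed.

Lemma setcolC (T : finType) (e : rel T) (A : {set T}) (c : nat) :
  setcol e A c -> setcol (fun x y => e y x) A c.
Proof.
by move=> [f [fb fe]]; exists f; split=> // x y xA yA /fe; rewrite eq_sym; apply.
Qed.

Lemma setcolU (T : finType) (e : rel T) (A B : {set T}) (a b : nat) :
  setcol e A a -> setcol e B b -> setcol e (A :|: B) (a + b).
Proof.
move=> [f [fb fe]] [g [gb ge]].
exists (fun x => if x \in A then f x else a + g x).
have inB x : x \in A :|: B -> (x \in A) = false -> x \in B by rewrite inE => /orP[->|].
split=> [x xAB|x y xAB yAB exy].
  by case: ifP => [/fb|/(inB x xAB) /gb]; lia.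
case: ifP => xA; case: ifP => yA; first by apply: fe.
- by have := fb _ xA; lia.
- by have := fb _ yA; lia.
- by rewrite eqn_add2l; apply: ge => //; apply: inB.
Qed.

Lemma setcol0 (T : finType) (e : rel T) : setcol e set0 0.
Proof. by exists (fun=> 0); split=> x; rewrite inE. Qed.

Lemma setcol1 (T : finType) (e : rel T) (x : T) : irreflexive e -> setcol e [set x] 1.
Proof.
move=> irr; exists (fun=> 0); split=> // y z; rewrite !inE => /eqP-> /eqP->.
by rewrite irr.
Qed.

Lemma setcol_cover (T : finType) (I : eqType) (e : rel T) (r : seq I)
    (F : I -> {set T}) (A : {set T}) (c : nat) :
  (forall x, x \in A -> exists2 i, i \in r & x \in F i) ->
  (forall i, i \in r -> setcol e (F i) c) -> setcol e A (size r * c).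
Proof.
elim: r A => [|i r IH] A cov col.
  apply: setcolS (setcol0 e) => //.
  by apply/subsetP => x /cov [].
apply: (@setcolS _ e A (F i :|: (A :\: F i)) _ (c + size r * c)); last first.
- apply: setcolU; first by apply: col; rewrite mem_head.
  apply: IH => [x|j jr]; last by apply: col; rewrite inE jr orbT.
  rewrite inE => /andP[xi /cov [j]]; rewrite inE => /orP[/eqP->|jr xj].
    by rewrite (negPf xi).
  by exists j.
- by rewrite /=; lia.
- by apply/subsetP => x xA; rewrite !inE xA andbT orbN.
Qed.

Lemma fresh_nat (s : seq nat) (n : nat) : size s < n -> exists2 c, c < n & c \notin s.
Proof.
move=> sn; apply: contrapT => H.
suff: n <= size s by lia.
rewrite -(size_iota 0 n); apply: uniq_leq_size; first exact: iota_uniq.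
move=> c; rewrite mem_iota => /= cn; apply: contrapT => /negP cs.
by apply: H; exists c.
Qed.

Lemma fresh_elem (T : finType) (A : {set T}) (s : seq T) :
  size s < #|A| -> exists2 x, x \in A & x \notin s.
Proof.
move=> sA; apply: contrapT => H.
suff: #|A| <= size s by lia.
rewrite cardE; apply: uniq_leq_size; first exact: enum_uniq.
move=> x; rewrite mem_enum => xA; apply: contrapT => /negP xs.
by apply: H; exists x.
Qed.

Lemma sum_outdeg_indeg (T : finType) (e : rel T) (A : {set T}) :
  \sum_(x in A) #|[set y in A | e x y]| = \sum_(x in A) #|[set y in A | e y x]|.
Proof.
have E (r : rel T) x : #|[set y in A | r x y]| = \sum_(y in A) r x y.
  by rewrite -sum1dep_card big_mkcondr /=; apply: eq_bigr => y _; case: (r x y).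
rewrite (eq_bigr _ (fun x _ => E e x)) exchange_big /=.
by apply: eq_bigr => x _; rewrite (E (fun a b => e b a)).
Qed.

(** Out-degrees and in-degrees within [A] have the same sum, so some vertex also has at most [t]
    in-neighbours. It has at most [2 * t] neighbours in all, and a colouring of the rest extends to
    it. *)
Lemma degenerate_setcol (T : finType) (e : rel T) (t : nat) (A : {set T}) :
  irreflexive e -> (forall x, x \in A -> #|[set y in A | e x y]| <= t) ->
  setcol e A (2 * t).+1.
Proof.
move=> irr; have [n] := ubnP #|A|; elim: n A => // n IH A /ltnSE An deg.
case: (set_0Vmem A) => [->|[x0 x0A]]; first exact: (setcolS _ _ (setcol0 e)).
have [x xA xdeg]: exists2 x, x \in A & #|[set y in A | e y x]| <= t.
  apply: contrapT => H.
  have: \sum_(x in A) t.+1 <= \sum_(x in A) #|[set y in A | e y x]|.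
    apply: leq_sum => x xA; rewrite ltnNge; apply/negP => ?; apply: H; by exists x.
  rewrite -sum_outdeg_indeg; apply/negP; rewrite -ltnNge.
  apply: (@leq_ltn_trans (\sum_(x in A) t)); first exact: leq_sum.
  by rewrite !sum_nat_const ltn_pmul2l //; apply/card_gt0P; exists x0.
have [||f [fb fe]] := IH (A :\ x).
- by have := cardsD1 x A; rewrite xA; lia.
- move=> y; rewrite inE => /andP[_ yA]; apply: leq_trans (deg y yA).
  by apply: subset_leq_card; apply/subsetP => z; rewrite !inE => /andP[/andP[_ ->]].
pose B := [set y in A | e x y] :|: [set y in A | e y x].
have [|c cn cB] := @fresh_nat [seq f y | y <- enum B] (2 * t).+1.
  rewrite size_map -cardE; have := (leq_card_setU [set y in A | e x y] [set y in A | e y x]).1.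
  by rewrite -/B; have := deg x xA; lia.
have fB y : y \in B -> f y != c.
  by move=> yB; apply: contraNneq cB => <-; apply: map_f; rewrite mem_enum.
exists (fun y => if y == x then c else f y); split=> [y yA|y z yA zA eyz].
  by case: (eqVneq y x) => // yx; apply: fb; rewrite !inE yx.
case: (eqVneq y x) => [yx|yx]; case: (eqVneq z x) => [zx|zx].
- by rewrite yx zx irr in eyz.
- by rewrite eq_sym; apply: fB; rewrite !inE zA -yx eyz.
- by apply: fB; rewrite !inE yA -zx eyz orbT.
- by apply: fe => //; rewrite !inE ?yx ?zx.
Qed.

(** * Oriented paths and cycles with a prescribed word *)

Definition step (T : Type) (e : rel T) (b : bool) (x y : T) : bool :=
  if b then e x y else e y x.

Lemma setcol_step (T : finType) (e : rel T) (b : bool) (A : {set T}) (c : nat) :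
  setcol (fun x y => step e b y x) A c -> setcol e A c.
Proof. by case: b => // /setcolC. Qed.

Fixpoint walk (T : Type) (e : rel T) (x : T) (w : seq bool) (p : seq T) : bool :=
  match w, p with
  | [::], [::] => true
  | b :: w', y :: p' => step e b x y && walk e y w' p'
  | _, _ => false
  end.

Lemma size_walk (T : Type) (e : rel T) (x : T) w p : walk e x w p -> size p = size w.
Proof. by elim: w x p => [|b w IH] x [|y p] //= /andP[_ /IH ->]. Qed.

Lemma walk_cat (T : Type) (e : rel T) (x : T) w1 p1 w2 p2 :
  walk e x w1 p1 -> walk e (last x p1) w2 p2 -> walk e x (w1 ++ w2) (p1 ++ p2).
Proof. by elim: w1 x p1 => [|b w IH] x [|y p] //= /andP[-> ] /IH. Qed.

Lemma walk_catP (T : Type) (e : rel T) (x : T) w1 w2 p :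
  walk e x (w1 ++ w2) p ->
  exists p1 p2, [/\ p = p1 ++ p2, walk e x w1 p1 & walk e (last x p1) w2 p2].
Proof.
elim: w1 x p => [|b w IH] x p /=; first by exists [::], p.
case: p => //= y p /andP[st /IH [p1 [p2 [-> W1 W2]]]].
by exists (y :: p1), p2; rewrite /= st W1.
Qed.

Lemma walk_nthP (T : Type) (x0 : T) (e : rel T) (x : T) w p : 
  walk e x w p <-> size p = size w /\
    forall i, i < size w -> step e (nth false w i) (nth x0 (x :: p) i) (nth x0 (x :: p) i.+1).
Proof.
split.
  elim: w x p => [|b w IH] x [|y p] //= /andP[st /IH [-> H]].
  by split=> // -[|i] /=; last exact: H.
elim: w x p => [|b w IH] x [|y p] //= [] // [sz] H.
rewrite (H 0) //=; apply: IH; split=> // i; exact: (H i.+1).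
Qed.

(** Induction on the word. The vertices with at most [t] possible predecessors for the first letter
    are coloured with [(2 * t).+1] colours and deleted. A path for the remaining letters then starts
    at a vertex with more than [t] predecessors in [A], one of which is off the path. *)
Lemma walk_in_setcol (T : finType) (e : rel T) (t : nat) (w : seq bool) (A : {set T}) :
  irreflexive e -> size w <= t -> ~ setcol e A (size w * (2 * t).+1) ->
  exists x p, [/\ walk e x w p, uniq (x :: p) & {subset x :: p <= A}].
Proof.
move=> irr; elim: w A => [|b w IH] A /= wt ncol.
  case: (set_0Vmem A) => [A0|[x xA]]; first by case: ncol; rewrite A0; exact: setcol0.
  by exists x, [::]; split=> // y; rewrite inE => /eqP ->.
(* [r y x] says that [x] can stand just before [y] for the letter [b]. *)
pose r : rel T := fun x y => step e b y x.
pose Z := [set y in A | #|[set z in A | r y z]| <= t].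
have rirr : irreflexive r by move=> y; rewrite /r /step; case: (b); rewrite irr.
have colZ : setcol e Z (2 * t).+1.
  apply: (@setcol_step _ e b); apply: degenerate_setcol => // y; rewrite inE => /andP[yA]; apply: leq_trans.
  by apply: subset_leq_card; apply/subsetP => z; rewrite !inE => /andP[/andP[->]].
have [| |y [p [W U sub]]] := IH (A :\: Z); first lia.
  move=> col; apply: ncol; apply: (setcolS _ _ (setcolU colZ col)); last by lia.
  by apply/subsetP => y yA; rewrite !inE yA andbT orbN.
have sub' : {subset y :: p <= A} by move=> z /sub; rewrite inE => /andP[].
have: y \in A :\: Z by apply: sub; rewrite mem_head.
rewrite !inE => /andP[]; rewrite sub' ?mem_head //= -ltnNge => degy _.
have [|x] := @fresh_elem _ [set z in A | r y z] (y :: p).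
  by rewrite /= (size_walk W); lia.
rewrite inE => /andP[xA rx] xyp; exists x, (y :: p); split.
- by rewrite /= -/(r y x) rx.
- by rewrite /= xyp; move: U.
- by move=> z; rewrite inE => /orP[/eqP->|/sub'].
Qed.

Definition has_cycle (T : eqType) (e : rel T) (w : seq bool) : Prop :=
  exists x p, walk e x w (rcons p x) /\ uniq (x :: p).

Lemma has_cycle_rot1 (T : eqType) (e : rel T) b w :
  has_cycle e (rcons w b) -> has_cycle e (b :: w).
Proof.
move=> [x [p [W U]]]; move: W; rewrite -(cats1 w) => W; have [p1 [p2 [E W1]]] := walk_catP W.
case: p2 E {W} => [|y [|z p2]] E //=; last by rewrite andbF.
rewrite andbT; move: E; rewrite cats1 => /rcons_inj [Ep <-] st; subst p1.
case/lastP: p => [|p z] in W1 U st *.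
  by exists x, [::]; case: (w) W1 => //= _; rewrite st.
exists z, (x :: p); rewrite last_rcons in st; rewrite rcons_cons /= st W1; split=> //.
by move: U; rewrite -rcons_cons rcons_uniq => /andP[-> ].
Qed.

Lemma has_cycle_rot (T : eqType) (e : rel T) w1 w2 :
  has_cycle e (w1 ++ w2) -> has_cycle e (w2 ++ w1).
Proof.
elim/last_ind: w2 w1 => [|w2 b IH] w1; first by rewrite cats0.
by rewrite -rcons_cat => /has_cycle_rot1 /= H; rewrite cat_rcons; apply: IH.
Qed.

(** * Sufficiency: linear out-degree and large chromatic number *)

Section Dense.
Variables (T : finType) (e : rel T) (s : nat).
Hypothesis irr : irreflexive e.
Hypothesis outdeg_s : forall x, #|T| <= s * #|[set y | e x y]|.
Local Notation N x := [set y | e x y].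

(* Choosing greedily, each new out-neighbour serves at least [#|B| / s] of the
   [#|B|] vertices not served so far. *)
Lemma greedy_sample (j : nat) : exists2 cs : seq T, size cs <= j &
  let B := [set x | ~~ has (e x) cs] in
  2 * s * #|B| <= #|T| \/ j * #|T| <= 2 * s ^ 2 * (#|T| - #|B|).
Proof.
elim: j => [|j [cs szcs /=]]; first by exists [::] => //; right; rewrite mul0n.
set B := [set x | _] => H.
have [small|big] := leqP (2 * s * #|B|) #|T|; first by exists cs; [exact: leqW | left].
have {H} H : j * #|T| <= 2 * s ^ 2 * (#|T| - #|B|) by case: H => // H; move: big; rewrite ltnNge H.
have [c cB]: exists c, #|B| <= s * #|[set x in B | e x c]|.
  apply: contrapT => /forallNP H'.
  have B0 : 0 < #|B| by case: (#|B|) big => //; rewrite muln0.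
  have T0 : 0 < #|T| by apply: leq_trans B0 (max_card _).
  have : \sum_(x in B) s * #|N x| <= \sum_(c : T) (#|B|.-1).
    have -> : \sum_(x in B) s * #|N x| = \sum_(c : T) s * #|[set x in B | e x c]|.
      rewrite -!big_distrr /=; congr (_ * _).
      under eq_bigr do rewrite -sum1dep_card big_mkcond.
      rewrite exchange_big /=; apply: eq_bigr => c _.
      by rewrite -sum1dep_card big_mkcondr.
    by apply: leq_sum => c _; have /negP := H' c; rewrite -ltnNge -{1}(ltn_predK B0).
  have : \sum_(x in B) #|T| <= \sum_(x in B) s * #|N x| by apply: leq_sum.
  by move=> ge /(leq_trans ge); rewrite !sum_nat_const mulnC leq_pmul2l // leqNgt ltn_predL B0.
exists (c :: cs); first by [].
right; set B' := [set x | _].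
have -> : #|B'| = #|B| - #|[set x in B | e x c]|.
  rewrite -(cardsID [set x in B | e x c] B).
  have -> : B :&: [set x in B | e x c] = [set x in B | e x c].
    by apply/setIidPr; apply/subsetP => x; rewrite inE => /andP[].
  rewrite addKn; congr #|pred_of_set _|; apply/setP => x; rewrite !inE /= negb_or.
  by case: (has _ _); case: (e x c).
have dB : #|[set x in B | e x c]| <= #|B|.
  by apply: subset_leq_card; apply/subsetP => x; rewrite inE => /andP[].
have -> : #|T| - (#|B| - #|[set x in B | e x c]|) =
    #|[set x in B | e x c]| + (#|T| - #|B|).
  by rewrite addnC subnA // max_card.
rewrite mulSn mulnDr leq_add // -mulnn mulnA -[_ * s * _]mulnA.
by apply: leq_trans (ltnW big) _; rewrite leq_mul2l cB orbT.
Qed.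

(** After [2 * s ^ 2] rounds, the second alternative of the greedy choice leaves no vertex unserved,
    so the first bound holds in either case. *)
Lemma dominating_sample : exists2 cs : seq T, size cs <= 2 * s ^ 2 &
  2 * s * #|[set x | ~~ has (e x) cs]| <= #|T|.
Proof.
have [cs szcs H] := greedy_sample (2 * s ^ 2); exists cs => //.
case: H => //; set B := [set x | _]; have : #|B| <= #|T| by exact: max_card.
move: #|B| #|T| => b n bn; have [->|s0] := posnP s; first by rewrite muln0.
rewrite leq_pmul2l ?muln_gt0 ?expn_gt0 ?s0 // => nb.
have -> : b = 0 by lia.
by rewrite muln0.
Qed.

(** Both ends of a path with word [w] reach the same [c] in two steps. At each end there are at
    least [K] middle vertices, which lets [a] and [b] avoid the path and each other. *)
Lemma UUDD_cycle (w : seq bool) (K : nat) :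
  size w + 4 <= K -> 4 * s ^ 3 * K < #|T| ->
  ~ setcol e [set: T] (2 * s ^ 2 * (size w * (2 * K).+1).+1) ->
  has_cycle e (w ++ [:: true; true; false; false]).
Proof.
move=> wK Tbig ncol; have [cs szcs few] := dominating_sample.
pose A c := [set x | K <= #|[set a in N x | e a c]|].
(* At most [#|T| / (2 * s)] out-neighbours of [x] miss the sample. If each [c] received fewer than
   [K] of the others, [s * #|N x|] would be at most [#|T| / 2 + 2 * s ^ 3 * K], which is less than
   [#|T|]. *)
have cov x : x \in [set: T] -> exists2 c, c \in cs & x \in A c.
  move=> _; apply: contrapT => H.
  have H1 : #|N x| <= #|[set y | ~~ has (e y) cs]| + \sum_(c <- cs) #|[set a in N x | e a c]|.
    apply: (@leq_trans #|[set y | ~~ has (e y) cs] :|: \bigcup_(c <- cs) [set a in N x | e a c]|).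
      apply: subset_leq_card; apply/subsetP => y yx; rewrite inE [in X in X || _]inE -implybE.
      apply/implyP => /hasP [c ccs yc]; rewrite (big_rem c) //= !inE.
      by move: yx; rewrite !inE => ->; rewrite yc.
    apply: leq_trans (leq_card_setU _ _).1 _; rewrite leq_add2l.
    elim: (cs) => [|c r IH]; first by rewrite !big_nil cards0.
    by rewrite !big_cons; apply: leq_trans (leq_card_setU _ _).1 _; rewrite leq_add2l.
  have H2 : \sum_(c <- cs) #|[set a in N x | e a c]| <= 2 * s ^ 2 * K.
    apply: (@leq_trans (\sum_(c <- cs) K)).
      rewrite !big_seq; apply: leq_sum => c ccs; rewrite leqNgt; apply/negP => ?.
      by apply: H; exists c => //; rewrite inE; apply: ltnW.
    by rewrite big_const_seq count_predT iter_addn_0 mulnC leq_mul2r szcs orbT.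
  have := outdeg_s x; have := leq_trans H1 (leq_add (leqnn _) H2).
  move: few Tbig; rewrite !expnS; move: #|N x| #|T| #|[set y | _]| => a n b; nia.
have [c ccs ncolc] : exists2 c, c \in cs & ~ setcol e (A c) (size w * (2 * K).+1).+1.
  apply: contrapT => H; apply: ncol.
  apply: (@setcolS _ e _ [set: T] _ (size cs * (size w * (2 * K).+1).+1)) => //.
    by rewrite leq_mul2r szcs orbT.
  apply: setcol_cover cov _ => c ccs; apply: contrapT => H'; apply: H; by exists c.
(* The vertex [c] may lie in [A c]; removing it costs one colour. *)
have [||x [p [W U sub]]] := @walk_in_setcol _ e K w (A c :\ c) irr; first by lia.
  move=> col; apply: ncolc; rewrite -add1n.
  apply: setcolS (setcolU (setcol1 c irr) col) => //.
  by apply/subsetP => x xA; rewrite !inE; case: eqP => //= _; move: xA; rewrite inE.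
have cxp : c \notin x :: p by apply/negP => /sub; rewrite !inE eqxx.
have szp := size_walk W.
have many z : z \in x :: p -> K <= #|[set a in N z | e a c]|.
  by move/sub; rewrite !inE => /andP[_].
have [|b] := @fresh_elem _ [set a in N (last x p) | e a c] (x :: p).
  by have := many _ (mem_last x p); rewrite /=; lia.
rewrite inE => /andP[]; rewrite inE => yb bc bxp.
have [|a] := @fresh_elem _ [set a in N x | e a c] (b :: x :: p).
  by have := many _ (mem_head x p); rewrite /=; lia.
rewrite inE => /andP[]; rewrite inE => xa ac; rewrite (in_cons b) negb_or => /andP[ab axp].
exists x, (p ++ [:: b; c; a]); split.
  by rewrite rcons_cat; apply: walk_cat W _; rewrite /= yb bc ac xa.
rewrite -cat_cons cat_uniq U [has _ _]/= (negPf bxp) (negPf cxp) (negPf axp) /= !inE.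
have ne u : e u c -> u != c by apply: contraTneq => ->; rewrite irr.
by rewrite negb_or (ne b bc) eq_sym ab eq_sym (ne a ac).
Qed.

(** Truncated inclusion-exclusion: [2 * s] out-neighbourhoods have total size at least [2 * #|T|],
    whereas intersections of size at most [K] would bound this total by [#|T| + (2 * s) ^ 2 * K],
    which is smaller. *)
Lemma common_out_pair (K : nat) (r : seq T) : uniq r -> 2 * s <= size r ->
  4 * s ^ 2 * K < #|T| ->
  exists x y, [/\ x \in r, y \in r, x != y & K <= #|N x :&: N y|].
Proof.
move=> Ur szr big; apply: contrapT => H.
have small x y : x \in r -> y \in r -> x != y -> #|N x :&: N y| <= K.
  by move=> xr yr xy; apply: ltnW; rewrite ltnNge; apply/negP => ?; apply: H; exists x, y.
have inter x q : (forall y, y \in q -> #|N x :&: N y| <= K) ->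
    #|N x :&: \bigcup_(y <- q) N y| <= size q * K.
  elim: q => [|y q IH] Hq; first by rewrite big_nil setI0 cards0.
  rewrite big_cons setIUr; apply: leq_trans (leq_card_setU _ _).1 _.
  rewrite mulSn leq_add ?Hq ?mem_head //.
  by apply: IH => z zq; apply: Hq; rewrite inE zq orbT.
have key q : uniq q -> {subset q <= r} ->
    \sum_(x <- q) #|N x| <= #|\bigcup_(x <- q) N x| + size q ^ 2 * K.
  elim: q => [|x q IH] /=; first by rewrite !big_nil.
  move=> /andP[xq Uq] sub; rewrite !big_cons cardsU.
  have sub' : {subset q <= r} by move=> y yq; apply: sub; rewrite inE yq orbT.
  have := IH Uq sub'; have : #|N x :&: \bigcup_(y <- q) N y| <= size q * K.
    apply: inter => y yq; apply: small; [exact/sub/mem_head | exact: sub' |].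
    by apply: contraNneq xq => ->.
  have : #|N x :&: \bigcup_(y <- q) N y| <= #|N x| by apply/subset_leq_card/subsetIl.
  have -> : (size q).+1 ^ 2 = size q ^ 2 + size q + (size q).+1 by rewrite -!mulnn; nia.
  rewrite !mulnDl; have -> : (size q).+1 * K = K + size q * K by rewrite mulSn.
  have arith (n a b i q1 q2 : nat) : i <= n -> i <= q1 -> a <= b + q2 ->
    n + a <= n + b - i + (q2 + q1 + (K + q1)) by lia.
  exact: arith.
pose q := take (2 * s) r.
have szq : size q = 2 * s by apply: size_takel.
have := key q (take_uniq _ Ur) (fun x => @mem_take _ _ _ x); rewrite szq.
have H1 : #|\bigcup_(x <- q) N x| <= #|T| by exact: max_card.
have H2 : 2 * s * #|T| <= s * \sum_(x <- q) #|N x|.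
  rewrite big_distrr /= -szq; elim: (q) => [|x q' IH]; first by rewrite big_nil.
  by rewrite big_cons mulSn leq_add.
have s0 : 0 < s.
  have /card_gt0P [x _] : 0 < #|T| by apply: leq_ltn_trans big.
  by have := outdeg_s x; case: (s) => //; move: big; rewrite mul0n; lia.
have arith (n a b : nat) : b <= n -> 2 * s * n <= s * a -> 4 * s ^ 2 * K < n ->
    a <= b + (2 * s) ^ 2 * K -> False.
  rewrite -!mulnn => bn sn nK ab.
  have : 2 * n <= a by rewrite -(leq_pmul2l s0); lia.
  lia.
exact: arith H1 H2 big.
Qed.

End Dense.

(* Induction on [m]: if the non-neighbours of some vertex are not colourable
   with few colours, they contain no independent set of size [m - 1]; otherwise
   deleting the non-neighbours of a first path leaves room for the second. *)
Lemma linked_walks (w1 w2 : seq bool) (m : nat) : exists c : nat,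
  forall (T : finType) (e G : rel T) (A : {set T}), irreflexive e -> symmetric G ->
  (forall r, uniq r -> {subset r <= A} -> m <= size r ->
     exists x y, [/\ x \in r, y \in r, x != y & G x y]) ->
  ~ setcol e A c ->
  exists x1 p1 x2 p2, [/\ walk e x1 w1 p1, walk e x2 w2 p2,
    uniq ((x1 :: p1) ++ (x2 :: p2)) &
    forall u v, u \in x1 :: p1 -> v \in x2 :: p2 -> G u v].
Proof.
elim: m => [|m [c IH]].
  exists 0 => T e G A _ _ /(_ [::] isT) [] //.
  by move=> x [y []].
pose b1 := size w1 * (2 * size w1).+1; pose b2 := size w2 * (2 * size w2).+1.
exists (b1 + ((size w1).+1 * (c + 1) + b2)) => T e G A irr sym alpha ncol.
pose B v := [set u in A | (u != v) && ~~ G v u].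
have [[v [vA ncolB]]|small] := pselect (exists v, v \in A /\ ~ setcol e (B v) c).
  (* Given [m] vertices of [B v], some pair among them and [v] is joined in [G]. The pair avoids
     [v], to which none of them is joined. *)
  apply: (IH T e G (B v)) => // r Ur sub szr.
  have Bv u : u \in r -> [/\ u \in A, u != v & G v u = false].
    by move/sub; rewrite inE => /and3P[-> -> /negPf].
  have [|z||x [y [xr yr xy Gxy]]] := alpha (v :: r).
  - by rewrite /= Ur andbT; apply/negP => /Bv []; rewrite eqxx.
  - by rewrite inE => /orP[/eqP->|/Bv []].
  - by [].
  move: xr yr; rewrite !inE => /orP[/eqP xv|xr] /orP[/eqP yv|yr].
  - by rewrite xv yv eqxx in xy.
  - by have [_ _] := Bv _ yr; rewrite -xv Gxy.
  - by have [_ _] := Bv _ xr; rewrite -yv sym Gxy.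
  - by exists x, y.
have [||x1 [p1 [W1 U1 sub1]]] := @walk_in_setcol _ e (size w1) w1 A irr; first by [].
  by move=> col; apply: ncol; apply: setcolS col => //; apply: leq_addr.
(* A path outside [Z] is disjoint from the first one and completely joined to it in [G]. *)
pose Z := [set u in A | has (fun v => (u == v) || ~~ G v u) (x1 :: p1)].
have colZ : setcol e Z ((size w1).+1 * (c + 1)).
  rewrite -(size_walk W1) -[_.+1]/(size (x1 :: p1)).
  apply: (setcol_cover (F := fun v => B v :|: [set v])) => [u|v vp].
    rewrite inE => /andP[uA /hasP [v vp uv]]; exists v => //.
    by rewrite !inE uA /=; move: uv; case: (u == v); rewrite ?orbT ?orbF.
  apply: setcolU (setcol1 _ irr); apply: contrapT => ncolB; apply: small.
  by exists v; split=> //; apply: sub1.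
have [||x2 [p2 [W2 U2 sub2]]] := @walk_in_setcol _ e (size w2) w2 (A :\: Z) irr.
- by [].
- move=> col; apply: ncol; apply: (setcolS _ _ (setcolU colZ col)); last exact: leq_addl.
  by apply/subsetP => u uA; rewrite !inE uA andbT orbN.
have link u v : u \in x1 :: p1 -> v \in x2 :: p2 -> v != u /\ G u v.
  move=> up /sub2; rewrite in_setD inE => /andP[+ vA]; rewrite vA => /hasPn H; move: (H u up).
  by rewrite negb_or negbK => /andP[].
exists x1, p1, x2, p2; split=> // [|u v up /(link u v up) []//].
rewrite cat_uniq U1 U2 andbT; apply/hasPn => v v2; apply/negP => v1.
by have [] := link v v v1 v2; rewrite eqxx.
Qed.

(** The sink [a] joins the end of the first path to the start of the second, and the sink [b] joins
    the end of the second to the start of the first. *)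
Lemma two_sinks_cycle (w1 w2 : seq bool) (s : nat) : exists c : nat,
  forall (T : finType) (e : rel T), irreflexive e ->
  (forall x, #|T| <= s * #|[set y | e x y]|) -> c < #|T| -> ~ setcol e [set: T] c ->
  has_cycle e (w1 ++ [:: true; false] ++ w2 ++ [:: true; false]).
Proof.
have [c link] := linked_walks w1 w2 (2 * s).
pose K := size w1 + size w2 + 4.
(* The sum serves twice: as a lower bound on [#|T|] for [common_out_pair] and as a number of colours
   for [linked_walks]. *)
exists (4 * s ^ 2 * K + c) => T e irr deg big ncol.
pose G x y := K <= #|[set z | e x z] :&: [set z | e y z]|.
have Gsym : symmetric G by move=> x y; rewrite /G setIC.
have [r Ur _ szr||x1 [p1 [x2 [p2 [W1 W2 U lk]]]]] := link T e G [set: T] irr Gsym.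
- by apply: common_out_pair szr _ => //; apply: leq_ltn_trans big; apply: leq_addr.
- by move=> col; apply: ncol; apply: setcolS col => //; apply: leq_addl.
set q := _ ++ _ in U.
have szq : size q = size w1 + size w2 + 2.
  by rewrite size_cat /= (size_walk W1) (size_walk W2); lia.
have [|a] := @fresh_elem _ ([set z | e (last x1 p1) z] :&: [set z | e x2 z]) q.
  by apply: leq_trans (lk _ _ (mem_last x1 p1) (mem_head x2 p2)); rewrite szq /K; lia.
rewrite in_setI !in_set => /andP[ya xa] aq.
have [|b] := @fresh_elem _ ([set z | e (last x2 p2) z] :&: [set z | e x1 z]) (a :: q).
  rewrite setIC; apply: leq_trans (lk _ _ (mem_head x1 p1) (mem_last x2 p2)).
  by rewrite -[size _]/(size q).+1 szq /K; lia.
rewrite in_setI !in_set => /andP[yb xb]; rewrite in_cons negb_or => /andP[ba bq].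
exists x1, (p1 ++ a :: x2 :: p2 ++ [:: b]); split.
  rewrite rcons_cat; apply: walk_cat W1 _; rewrite /= ya xa /= rcons_cat /=.
  by apply: walk_cat W2 _; rewrite /= yb xb.
suff: perm_eq (x1 :: (p1 ++ a :: x2 :: p2 ++ [:: b])) ([:: b; a] ++ q).
  move/perm_uniq ->; rewrite cat_uniq U [uniq _]/= inE ba !andbT.
  by apply/hasPn => z zq; rewrite !inE; apply/norP; split; apply: contraTneq zq => ->.
by apply/permP => P; rewrite /q /= !count_cat /= !count_cat /=; lia.
Qed.

Lemma cycle_of_large_chi (w : seq bool) (s : nat) :
  (exists w1 w2, w = w1 ++ [:: true; false] ++ w2 ++ [:: true; false]) \/
  (exists w1, w = w1 ++ [:: true; true; false; false]) ->
  exists c : nat, forall (T : finType) (e : rel T), irreflexive e ->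
  (forall x, #|T| <= s * #|[set y | e x y]|) -> c < #|T| -> ~ setcol e [set: T] c ->
  has_cycle e w.
Proof.
move=> [[w1 [w2 ->]]|[w1 ->]]; first exact: two_sinks_cycle.
pose K := size w1 + 4.
exists (4 * s ^ 3 * K + (2 * s ^ 2 * (size w1 * (2 * K).+1).+1)) => T e irr deg big ncol.
apply: (@UUDD_cycle _ e s irr deg w1 K) => //.
  by apply: leq_ltn_trans big; apply: leq_addr.
by move=> col; apply: ncol; apply: setcolS col => //; apply: leq_addl.
Qed.

(** * Chromatic number of shift graphs *)

Lemma card_finset (T : finType) : #|{set T}| = 2 ^ #|T|.
Proof.
by rewrite -[#|T|]cardsT -card_powerset; apply: eq_card => A; rewrite !inE subsetT.
Qed.

Definition increasing (n : nat) (s : seq 'I_n) : bool :=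
  sorted (fun a b : 'I_n => a < b) s.

(** Shortening the tuples by one entry replaces colours by sets of colours: [g s] collects the
    colours of the increasing extensions of [s]. If [g (a :: s)] equalled [g (rcons s b)], the
    colour of [a :: rcons s b] would reappear on some [rcons (rcons s b) c], a shift of it. *)
Lemma shift_coloring (r n : nat) (T : finType) (f : seq 'I_n -> T) :
  (forall a s b, size s = r -> increasing (a :: rcons s b) ->
     f (a :: s) != f (rcons s b)) ->
  n <= iter r (expn 2) #|T|.
Proof.
elim: r T f => [|r IH] T f fP.
  rewrite -[n in n <= _]card_ord; apply: (@leq_card _ _ (fun a : 'I_n => f [:: a])) => a b fab.
  apply: contrapT => ab.
  have /orP[lt|lt] : (a < b) || (b < a) by rewrite -neq_ltn; apply/eqP => /val_inj.
  - by have /= := fP a [::] b erefl; rewrite /increasing /= lt fab eqxx => /(_ isT).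
  - by have /= := fP b [::] a erefl; rewrite /increasing /= lt fab eqxx => /(_ isT).
pose g s := [set f (rcons s b) | b : 'I_n & increasing (rcons s b)].
rewrite iterSr -card_finset; apply: (IH _ g) => a s b sz inc.
apply/eqP => gE; have : f (a :: rcons s b) \in g (a :: s).
  by apply/imsetP; exists b; rewrite ?inE.
rewrite gE => /imsetP [c]; rewrite inE => inc' fE.
have : increasing (a :: rcons (rcons s b) c).
  rewrite /increasing /= rcons_path; move: inc => /= -> /=; rewrite last_rcons.
  by move: inc'; case: (s) => [|x s'] /=; rewrite /increasing /= ?andbT // rcons_path last_rcons => /andP[].
by move/fP; rewrite size_rcons sz fE eqxx => /(_ erefl).
Qed.

(** * Necessity: a dense digraph without short closed walks or chords *)

Fixpoint dwalk (T : Type) (e : rel T) (j : nat) (x y : T) : Prop :=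
  if j is j'.+1 then exists2 z, e x z & dwalk e j' z y else x = y.

Section ShiftTower.
Variables (m t n N : nat).
Hypothesis t0 : 0 < t.

(* Increasing tuples form a shift graph [H]; [W] is a blow-up of the directed
   cycle of length [m]. An increasing tuple [u] sends arcs to the copies of the
   sets [S] in level 0 with [u_0 \in S] and [u_t \notin S]: if [v] is reached from
   [u] in [t] steps then [v_0 = u_t], so [u] and [v] have no common out-neighbour
   in [W]. *)
Local Notation H := (t.+1.-tuple 'I_n).
Local Notation W := ('I_m.+1 * ({set 'I_n} * 'I_N))%type.

Definition shift_rel : rel H := fun u v =>
  [&& increasing u, increasing v & behead u == take t v].

(** Non-increasing tuples are isolated in the shift graph; the implication joins them to all of
    level 0, so that their out-degree is large too. *)
Definition separated (u : H) (S : {set 'I_n}) : bool :=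
  increasing u ==> (thead u \in S) && (tnth u ord_max \notin S).

Definition tower_rel : rel (H + W) := fun x y =>
  match x, y with
  | inl u, inl v => shift_rel u v
  | inl u, inr w => (w.1 == ord0) && separated u w.2.1
  | inr w, inl _ => false
  | inr w, inr w' => val w'.1 == w.1.+1 %% m.+1
  end.

Lemma shift_rel_nth (u v : H) (a0 : 'I_n) i : shift_rel u v -> i < t ->
  nth a0 v i = nth a0 u i.+1.
Proof.
move=> /and3P[_ _ /eqP uv] it.
by rewrite -(nth_take _ it) -uv nth_behead.
Qed.

Lemma shift_rel_lt (u v : H) (a0 : 'I_n) : shift_rel u v -> nth a0 u 0 < nth a0 v 0.
Proof.
move=> uv; rewrite (shift_rel_nth a0 uv t0); have /and3P[inc _ _] := uv.
move: inc; rewrite /increasing; have := size_tuple u.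
by case: (tval u) t0 => [|a [|b s]] //=; [move: t0; case: (t) | move=> _ _ /andP[]].
Qed.

Lemma dwalk_shift (a0 : 'I_n) j (u v : H) : dwalk shift_rel j u v ->
  (nth a0 u 0 + j <= nth a0 v 0) /\
  forall i, i + j <= t -> nth a0 v i = nth a0 u (i + j).
Proof.
elim: j u => [|j IH] u /=; first by move=> ->; split=> [|i _]; rewrite addn0.
move=> [z uz /IH [le eqn]]; have lt := shift_rel_lt a0 uz; split; first lia.
by move=> i ij; rewrite eqn ?(shift_rel_nth a0 uz) ?addnS //; lia.
Qed.

Lemma dwalk_increasing j (u v : H) : 0 < j -> dwalk shift_rel j u v ->
  increasing u /\ increasing v.
Proof.
elim: j u => // j IH u _ /= [z /and3P[incu incz _]]; case: j IH => [_ <- //|j IH].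
by move=> /(IH _ isT) [].
Qed.

Lemma dwalk_tower_inr j (w : W) y : dwalk tower_rel j (inr w) y ->
  exists2 w' : W, y = inr w' & val w'.1 = (w.1 + j) %% m.+1.
Proof.
elim: j w => [|j IH] w /=; first by move=> <-; exists w => //; rewrite addn0 modn_small.
move=> [[//|z] /eqP zE /IH [w' -> wE]]; exists w' => //.
by rewrite wE zE modnDml addSnnS.
Qed.

(** No arc returns from [W] to [H]: a walk leaves [H] at most once, entering level 0, and every
    later step raises the level by one modulo [m.+1]. *)
Lemma dwalk_tower_inl j (u : H) y : dwalk tower_rel j (inl u) y ->
  (exists2 v : H, y = inl v & dwalk shift_rel j u v) \/
  exists (w : W) i v, [/\ y = inr w, i < j, dwalk shift_rel i u v,
    (i.+1 = j -> separated v w.2.1) & val w.1 = (j - i.+1) %% m.+1].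
Proof.
elim: j u => [|j IH] u /=; first by move=> <-; left; exists u.
move=> [[z|z]].
  move=> uz /IH [[v -> zv]|[w [i [v [-> ij zv sep wE]]]]]; first by left; exists v => //; exists z.
  right; exists w, i.+1, v; split=> //=; first by exists z.
  by move=> [/sep].
move=> /andP[/eqP z0 sep] zy; right; have [w yE wE] := dwalk_tower_inr zy.
exists w, 0, u; split=> //=; last by rewrite wE z0 add0n subn1.
by move=> [j0]; move: zy yE; rewrite -j0 /= => <- [<-].
Qed.

(** The first entry of a tuple strictly increases along the arcs of [H], and in [W] a level recurs
    only after a multiple of [m.+1] steps. *)
Lemma tower_no_closed_walk j x : 0 < j < m.+1 -> ~ dwalk tower_rel j x x.
Proof.
move=> /andP[j0 jm]; case: x => [u|w].
  case/dwalk_tower_inl => [[v [<-]]|[w [i [v []//]]]].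
  by case/(dwalk_shift (thead u)); lia.
case/dwalk_tower_inr => w' [<-] => /eqP.
have wm : w.1 < m.+1 by [].
rewrite -[X in X == _](modn_small wm) -[X in X %% _ == _]addn0 eqn_modDl mod0n modn_small //.
by rewrite eq_sym; lia.
Qed.

(** Within [H], the walk raises the first entry further than a single arc does; within [W], the
    levels differ. From [H] to level 0 of [W], the walk must spend [t] steps in [H], reaching a
    tuple whose first entry is the last entry of [u]; the target set would both contain and omit
    it. *)
Lemma tower_no_chord x y : t < m -> tower_rel x y -> ~ dwalk tower_rel t.+1 x y.
Proof.
move=> tm; case: x => [u|w] xy.
  case/dwalk_tower_inl => [[v yE]|[w [i [v [yE it uv sep wE]]]]]; subst y.
    move=> [z uz /(dwalk_shift (thead u)) [+ _]].
    by rewrite (shift_rel_nth _ uz t0) (shift_rel_nth _ xy t0); lia.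
  move: xy => /andP[/eqP w0 sepu].
  have iE : i = t.
    move: wE; rewrite w0 /= modn_small; last by lia.
    lia.
  subst i; have {}sep := sep erefl.
  have [_ /(_ 0 (leqnn t)) vE] := dwalk_shift (thead u) uv.
  have [incu incv] := dwalk_increasing t0 uv.
  move: sepu sep; rewrite /separated incu incv /= => /andP[_ /negP nS] /andP[S _].
  apply: nS; rewrite (tnth_nth (thead u)) /= -vE.
  by move: S; rewrite /thead (tnth_nth (thead u)).
case: y xy => // w' /eqP ww' /dwalk_tower_inr [w2 [<-]].
rewrite ww' => /eqP; rewrite -[in X in X == _]addn1 eqn_modDl !modn_small //; lia.
Qed.

(** For increasing [u], [f] records the membership of [a] and [b] in [S], then forces [a] in and [b]
    out. This embeds all sets into four copies of the separated ones. *)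
Lemma card_separated (u : H) : #|{set 'I_n}| <= 4 * #|[set S | separated u S]|.
Proof.
have [inc|ninc] := boolP (increasing u); last first.
  rewrite -[X in X <= _]cardsT; apply: (@leq_trans #|[set S | separated u S]|); last lia.
  by apply: subset_leq_card; apply/subsetP => S _; rewrite inE /separated (negPf ninc).
set a := thead u; set b := tnth u ord_max.
have ab : a != b.
  rewrite /a /b /thead !(tnth_nth a) neq_ltn.
  have := @sorted_ltn_nth _ (fun a b : 'I_n => a < b) (fun _ _ _ => @ltn_trans _ _ _) a u inc.
  by move=> /(_ 0 t); rewrite !inE size_tuple /= => ->.
pose f (S : {set 'I_n}) := (a \in S, b \in S, (a |: S) :\ b).
have f_inj : injective f.
  move=> S S' [aE bE E]; apply/setP => x.
  have := congr1 (fun A : {set _} => x \in A) E; rewrite !inE.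
  have [->|_] := eqVneq x b; first by rewrite bE.
  by have [->|_] := eqVneq x a; first by rewrite aE.
rewrite -[X in X <= _]cardsT -(card_imset _ f_inj).
apply: (@leq_trans #|setX [set: bool * bool] [set S | separated u S]|).
  apply: subset_leq_card; apply/subsetP => _ /imsetP [S _ ->].
  by rewrite !inE /= /separated -/a -/b !inE !eqxx (negPf ab) implybT.
by rewrite cardsX cardsT card_prod card_bool.
Qed.

(** The [N] copies of each set make a level at least as large as [H], so the digraph is at most
    [m.+2] times a level, and every vertex dominates at least a quarter of one level. *)
Lemma card_tower_le x : #|{: H}| <= N ->
  #|{: H + W}| <= 4 * m.+2 * #|[set y | tower_rel x y]|.
Proof.
move=> HN; have cW : #|{: H + W}| <= m.+2 * (#|{set 'I_n}| * N).
  rewrite card_sum !card_prod !card_ord mulSn leq_add2r.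
  apply: leq_trans HN _; rewrite leq_pmull //; apply/card_gt0P; by exists set0.
have out (P : {set {set 'I_n}}) i :
    (forall S c, S \in P -> tower_rel x (inr (i, (S, c)))) ->
    #|P| * N <= #|[set y | tower_rel x y]|.
  move=> PP; rewrite -[N in X in X <= _]card_ord -cardsT -cardsX.
  rewrite -(card_imset _ (f := fun p => inr (i, p) : H + W)); last by move=> ? ? [].
  apply: subset_leq_card; apply/subsetP => _ /imsetP [[S c] + ->].
  by rewrite !inE /= andbT => /PP; apply.
apply: leq_trans cW _; rewrite [4 * _]mulnC -mulnA leq_mul2l /=.
case: x out => [u|w] out.
  have := out [set S | separated u S] ord0; have := card_separated u.
  move=> le /(_ _); set q := #|[set y | _]| => H1.
  apply: (@leq_trans (4 * #|[set S | separated u S]| * N)); first by rewrite leq_mul2r le orbT.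
  by rewrite -mulnA leq_mul2l /=; apply: H1 => S c; rewrite inE /= => ->.
have := out [set: {set 'I_n}] (inord (w.1.+1 %% m.+1)); rewrite cardsT => H1.
apply: leq_trans (leq_pmull _ _) => //; apply: H1 => S c _ /=.
by rewrite inordK // ltn_pmod.
Qed.

Lemma tower_coloring c : 0 < n ->
  setcol tower_rel [set: H + W] c -> n <= iter t (expn 2) c.
Proof.
move=> n0 [f [fb fP]]; pose g x := Ordinal (fb x (in_setT x)); pose u0 : H := [tuple of nseq t.+1 (Ordinal n0)].
(* The default [u0] is harmless: only sequences of length [t.+1] are compared. *)
rewrite -[c]card_ord; apply: (@shift_coloring _ _ _ (fun s => g (inl (insubd u0 s)))).
move=> a s b sz inc; rewrite -val_eqE; apply: fP; rewrite ?in_setT //=.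
have sz1 : size (a :: s) == t.+1 by rewrite /= sz.
have sz2 : size (rcons s b) == t.+1 by rewrite size_rcons sz.
rewrite /shift_rel !val_insubd sz1 sz2 /= -cats1 take_cat sz ltnn subnn cats0 eqxx andbT.
move: inc; rewrite /increasing /= -cats1 => inc; apply/andP; split.
  by move: inc; rewrite cat_path => /andP[].
by move: inc; apply: path_sorted.
Qed.

End ShiftTower.

Lemma chi_le (D : digraph) (c : nat) : (chi D <= c) <-> setcol (@arc D) [set: D] c.
Proof.
rewrite /chi; case: ex_minnP => m /existsP [f /forallP fP] min; split=> [mc|[f' [fb fe]]].
  exists (fun x => val (f x)); split=> [x _|x y _ _ xy]; first exact: leq_trans (ltn_ord _) mc.
  by have /forallP /(_ y) := fP x; rewrite /underlying xy -val_eqE.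
apply: min; apply/existsP.
exists [ffun x => Ordinal (fb x (in_setT x))].
apply/forallP => x; apply/forallP => y; rewrite !ffunE -val_eqE /=.
by apply/implyP => /orP[/fe|/fe]; rewrite ?in_setT // eq_sym => ->.
Qed.

Lemma sparse_digraph (k c : nat) : 2 <= k -> exists D : digraph,
  [/\ c < chi D, forall x : D, #|D| <= 4 * k.+2 * outdeg x,
      forall x : D, ~ dwalk (@arc D) k x x &
      2 < k -> forall x y : D, arc x y -> ~ dwalk (@arc D) k.-1 x y].
Proof.
(* The [maxn] takes effect only for [k = 2], where the chord clause is void; for larger [k], [t.+1]
   is [k.-1]. The value of [n] is just beyond what [c] colours allow. *)
move=> k2; pose t := maxn 1 (k - 2); pose n := (iter t (expn 2) c).+1.
have t0 : 0 < t by rewrite /t; lia.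
pose N := #|{: t.+1.-tuple 'I_n}|.
have irr : irreflexive (@tower_rel k t n N).
  move=> x; apply/negP => xx; have k1 : 0 < 1 < k.+1 by lia.
  by apply: (@tower_no_closed_walk k t n N t0 _ x k1); exists x.
exists (Digraph irr); split.
- rewrite ltnNge; apply/negP => /chi_le /(tower_coloring (ltn0Sn _)).
  by rewrite ltnn.
- move=> x; exact: card_tower_le.
- by move=> x; apply: tower_no_closed_walk => //; lia.
- move=> k3 x y xy; have -> : k.-1 = t.+1 by rewrite /t; lia.
  by apply: tower_no_chord xy => //; rewrite /t; lia.
Qed.

(** * Blocks of an oriented cycle *)

Lemma block_extend (C : digraph) (H : {set C} * {set C * C}) : block_cand H ->
  exists B, [/\ B \in blocks C, H.1 \subset B.1 & H.2 \subset B.2].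
Proof.
move=> candH; pose P (K : {set C} * {set C * C}) :=
  [&& block_cand K, H.1 \subset K.1 & H.2 \subset K.2].
have PH : P H by rewrite /P candH !subxx.
case: (@arg_maxnP _ H P (fun K => #|K.1| + #|K.2|) PH) => B /and3P[cB s1 s2] maxB.
exists B; split=> //; rewrite inE /is_block cB; apply/forallP => K.
apply/implyP => /and3P[cK t1 t2].
have := maxB K; rewrite /P cK (subset_trans s1 t1) (subset_trans s2 t2) => /(_ isT) le.
have := subset_leq_card t1; have := subset_leq_card t2 => le2 le1.
have e1 : B.1 == K.1 by rewrite eqEcard t1 /=; move: le le1 le2; clear; move: #|_| #|_| #|_| #|_|; lia.
have e2 : B.2 == K.2 by rewrite eqEcard t2 /=; move: le le1 le2; clear; move: #|_| #|_| #|_| #|_|; lia.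
by rewrite (surjective_pairing K) (surjective_pairing B) (eqP e1) (eqP e2).
Qed.

Section CycleBlocks.
Variables (k : nat) (C : digraph) (v : 'I_k.+1 -> C) (d : 'I_k.+1 -> bool).
Hypothesis v_bij : bijective v.
Hypothesis edge_inj : injective (cycle_arc v d).
Hypothesis edgeP : forall x y : C, arc x y <-> exists i, cycle_arc v d i = (x, y).
Local Notation E := (cycle_arc v d).
Implicit Types H B : {set C} * {set C * C}.

Lemma cand_edge H a : block_cand H -> a \in H.2 -> exists i, E i = a.
Proof.
move=> /and3P[/forallP sub _ _] aH; have := sub a; rewrite aH /= => /and3P[/edgeP [i Ei] _ _].
by exists i; rewrite Ei -surjective_pairing.
Qed.

Lemma edge_vertices i : (E i = (v i, v (ordS i)) /\ d i) \/ (E i = (v (ordS i), v i) /\ ~~ d i).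
Proof. by rewrite /cycle_arc; case: (d i); [left | right]. Qed.

Lemma cand_vertices H i : block_cand H -> E i \in H.2 -> (v i \in H.1) && (v (ordS i) \in H.1).
Proof.
move=> /and3P[/forallP sub _ _] iH; have := sub (E i); rewrite iH /= => /and3P[_].
by case: (edge_vertices i) => -[-> _] /= -> ->.
Qed.

Lemma cand_turn H i : block_cand H -> E i \in H.2 -> E (ordS i) \in H.2 -> d i = d (ordS i).
Proof.
move=> /and3P[_ _ tf] iH i'H; apply: contrapT => dd.
have nE : E i != E (ordS i) by apply/eqP => /edge_inj ii; apply: dd; rewrite -ii.
have := forallP (forallP (forallP tf (v i)) (v (ordS i))) (v (ordS (ordS i))).
move: nE iH i'H dd; rewrite /cycle_arc.
case: (d i); case: (d (ordS i)) => // nE -> -> _ /=.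
- by rewrite ?andbF implybF negbK => /eqP E'; rewrite -E' eqxx in nE.
- by rewrite ?andbF implybF negbK => /eqP E'; rewrite -E' eqxx in nE.
Qed.

(** Edge [i] joins vertices [i] and [i + 1], so deleting edges [a] and [b] separates vertices
    [a + 1] to [b] from the others, and a connected subdigraph stays on one side. *)
Lemma cand_cut H (a b l l' : 'I_k.+1) : block_cand H -> a < b ->
  E a \notin H.2 -> E b \notin H.2 -> v l \in H.1 -> v l' \in H.1 ->
  (a < l <= b) = (a < l' <= b).
Proof.
move=> cH ab aH bH lH l'H; have [v' vK v'K] := v_bij.
have /and3P[_ /andP[_ /forallP conn] _] := cH.
have /forallP /(_ (v l')) := implyP (conn (v l)) lH; rewrite l'H /=.
have S i : E i \in H.2 -> (a < i <= b) = (a < ordS i <= b).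
  move=> iH; have ia : i != a by apply: contraNneq aH => <-.
  have ib : i != b by apply: contraNneq bH => <-.
  move: ia ib; rewrite -!val_eqE /=; have := ltn_ord i; have := ltn_ord b.
  have [ik|ik] := ltnP i k; first by rewrite modn_small; lia.
  have -> : i.+1 = k.+1 by have := ltn_ord i; lia.
  by rewrite modnn; lia.
pose e u w := ((u, w) \in H.2) || ((w, u) \in H.2).
pose A := [pred x | a < v' x <= b].
have step u w : (u, w) \in H.2 -> (u \in A) = (w \in A).
  move=> uw; have [i Ei] := cand_edge cH uw; rewrite !inE.
  have := S i; rewrite Ei uw => /(_ isT).
  by case: (edge_vertices i) => -[]; rewrite Ei => -[-> ->] _; rewrite !vK => ->.
have clA : fingraph.closed e A by move=> u w /orP[/step|/step].
by move/(closed_connect clA); rewrite !inE !vK.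
Qed.

Lemma edge_chain H (i j : 'I_k.+1) : block_cand H -> i <= j ->
  (forall l : 'I_k.+1, i <= l <= j -> E l \in H.2) -> d i = d j.
Proof.
move=> cH; have [m mE] : exists m, m = j - i by exists (j - i).
elim: m i mE => [|m IH] i mE ij run; first by congr d; apply: val_inj => /=; lia.
have iS : val (ordS i) = i.+1 by rewrite /= modn_small //; have := ltn_ord j; lia.
rewrite (cand_turn cH (run i _) (run (ordS i) _)) ?iS; try lia.
by apply: IH => [||l]; rewrite iS; [lia | lia | move=> il; apply: run; lia].
Qed.

(** By [cand_cut], all edges on one of the two sides between [i] and [j] belong to [H], and
    turn-freeness propagates the direction along that side. *)
Lemma cand_two_edges H (i j : 'I_k.+1) : block_cand H -> i < j ->
  E i \in H.2 -> E j \in H.2 ->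
  (forall l : 'I_k.+1, i <= l <= j -> d l = d i) \/
  (forall l : 'I_k.+1, (l <= i) || (j <= l) -> d l = d i).
Proof.
move=> cH ij iH jH.
have [in_|] := boolP [forall l : 'I_k.+1, (i <= l <= j) ==> (E l \in H.2)].
  left=> l /andP[il lj]; symmetry; apply: (edge_chain cH) => // r ?.
  by apply: (implyP (forallP in_ r)); lia.
rewrite negb_forall => /existsP [a]; rewrite negb_imply => /andP[ija aH].
have [out|] := boolP [forall l : 'I_k.+1, ((l <= i) || (j <= l)) ==> (E l \in H.2)].
  right=> l lij; have out' (r : 'I_k.+1) : (r <= i) || (j <= r) -> E r \in H.2.
    exact: implyP (forallP out r).
  have chain0 (r : 'I_k.+1) : r <= i -> d ord0 = d r.
    by move=> ri; apply: (edge_chain cH) => // q ?; apply: out'; lia.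
  have chainm (r : 'I_k.+1) : j <= r -> d r = d ord_max.
    move=> jr; apply: (edge_chain cH); first by rewrite -ltnS.
    by move=> q ?; apply: out'; lia.
  have wrap : d ord_max = d ord0.
    have -> : ord0 = ordS (ord_max : 'I_k.+1) by apply: val_inj; rewrite /= modnn.
    apply: (cand_turn cH); apply: out'; rewrite /= ?modnn //.
    by have := ltn_ord j; lia.
  case/orP: lij => [li|jl]; first by rewrite -!chain0.
  by rewrite chainm // wrap (chain0 i).
rewrite negb_forall => /existsP [b]; rewrite negb_imply => /andP[ijb bH].
have ai : a != i by apply: contraNneq aH => ->.
have aj : a != j by apply: contraNneq aH => ->.
have bi : b != i by apply: contraNneq bH => ->.
have bj : b != j by apply: contraNneq bH => ->.
have /andP[vi _] := cand_vertices cH iH; have /andP[vj _] := cand_vertices cH jH.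
move: ai aj bi bj ija ijb; rewrite -!val_eqE /= => ai aj bi bj ija ijb.
have [ba|ab] := ltnP b a.
  have := cand_cut cH ba bH aH vi vj; lia.
have := @cand_cut H a b i j cH _ aH bH vi vj; lia.
Qed.

Lemma edge_cand i : block_cand ([set v i; v (ordS i)], [set E i]).
Proof.
apply/and3P; split=> /=.
- apply/forallP => a; apply/implyP; rewrite !inE => /eqP ->.
  have -> : arc (E i).1 (E i).2 by apply/edgeP; exists i; rewrite -surjective_pairing.
  by case: (edge_vertices i) => -[-> _] /=; rewrite !eqxx ?orbT.
- rewrite /connected /=; apply/andP; split; first by apply/set0Pn; exists (v i); rewrite !inE eqxx.
  have sub x y : x \in [set v i; v (ordS i)] -> y \in [set v i; v (ordS i)] -> x != y ->
      ((x, y) \in [set E i]) || ((y, x) \in [set E i]).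
    case: (edge_vertices i) => -[-> _]; rewrite !inE => /orP[]/eqP -> /orP[]/eqP ->;
      by rewrite ?eqxx ?orbT.
  apply/forallP => x; apply/implyP => xi; apply/forallP => y; apply/implyP => yi.
  by have [->|xy] := eqVneq x y; [exact: connect0 | apply: connect1; apply: sub].
- apply/forallP => x; apply/forallP => y; apply/forallP => z; apply/implyP => xz.
  rewrite !inE; apply/andP; split; apply: contraNN xz => /andP[/eqP <-] /eqP [];
    by move=> ->.
Qed.

(** The blocks through edges 0, [i] and [j] are distinct by [cand_two_edges]: edges 0 and [j] agree
    in direction, but [i] breaks one side between them and the last edge breaks the other. *)
Lemma three_blocks (i j : 'I_k.+1) : 0 < i -> i < j -> j < k ->
  d ord0 -> ~~ d i -> d j -> ~~ d ord_max -> 3 <= #|blocks C|.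
Proof.
move=> i0 ij jk d0 /negPf di dj /negPf dm.
have [B0 [bB0 _ s0]] := block_extend (edge_cand ord0).
have [Bi [bBi _ si]] := block_extend (edge_cand i).
have [Bj [bBj _ sj]] := block_extend (edge_cand j).
move: s0 si sj; rewrite !sub1set => s0 si sj.
have cB B : B \in blocks C -> block_cand B by rewrite inE => /andP[].
have n0i : B0 != Bi.
  apply/eqP => BE; rewrite -BE in si; have [/(_ i)|/(_ i)] := @cand_two_edges B0 ord0 i (cB _ bB0) i0 s0 si.
  - by rewrite d0 di leqnn (ltnW i0) => /(_ isT).
  - by rewrite d0 di leqnn orbT => /(_ isT).
have nij : Bi != Bj.
  apply/eqP => BE; rewrite -BE in sj; have [/(_ j)|/(_ j)] := cand_two_edges (cB _ bBi) ij si sj.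
  - by rewrite dj di leqnn (ltnW ij) => /(_ isT).
  - by rewrite dj di leqnn orbT => /(_ isT).
have n0j : B0 != Bj.
  have j0 : (ord0 : 'I_k.+1) < j by exact: ltn_trans ij.
  apply/eqP => BE; rewrite -BE in sj; have [/(_ i)|/(_ ord_max)] := cand_two_edges (cB _ bB0) j0 s0 sj.
  - by rewrite d0 di (ltnW i0) (ltnW ij) => /(_ isT).
  - by rewrite d0 dm (ltnW jk) orbT => /(_ isT).
have -> : 3 = #|[set B0; Bi; Bj]|.
  by rewrite -setUA cardsU1 cards2 !inE negb_or n0i n0j nij.
by apply: subset_leq_card; apply/subsetP => B; rewrite !in_setU !in_set1 => /orP[/orP[]|] /eqP ->.
Qed.

(** The index interval does not wrap around: the cycle will be rotated so that a change of
    direction, if any, lies between the last edge and edge 0. *)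
Definition run (a b : 'I_k.+1) : {set C} * {set C * C} :=
  ([set x | [exists l : 'I_k.+1, (a <= l <= b) && ((x == v l) || (x == v (ordS l)))]],
   [set E l | l : 'I_k.+1 & a <= l <= b]).

Lemma run_edge (a b l : 'I_k.+1) : (E l \in (run a b).2) = (a <= l <= b).
Proof.
apply/imsetP/idP => [[l' + /edge_inj ->]|lab]; first by rewrite inE.
by exists l => //; rewrite inE.
Qed.

Lemma run_vertex (a b l : 'I_k.+1) : a <= l <= b -> v l \in (run a b).1 /\ v (ordS l) \in (run a b).1.
Proof.
by move=> lab; split; rewrite inE; apply/existsP; exists l; rewrite lab eqxx ?orbT.
Qed.

Lemma run_cand (a b : 'I_k.+1) : a <= b ->
  (forall l : 'I_k.+1, a <= l <= b -> d l = d a) -> block_cand (run a b).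
Proof.
move=> ab dl; apply/and3P; split.
- apply/forallP => x; apply/implyP => /imsetP [l]; rewrite inE => lab ->.
  have -> : arc (E l).1 (E l).2 by apply/edgeP; exists l; rewrite -surjective_pairing.
  have [vl vl'] := run_vertex lab.
  by case: (edge_vertices l) => -[-> _] /=; rewrite /= in vl vl'; rewrite vl vl'.
- apply/andP; split; first by apply/set0Pn; exists (v a); have [|] := @run_vertex a b a _; rewrite ?leqnn.
  pose e : rel C := fun u w => ((u, w) \in (run a b).2) || ((w, u) \in (run a b).2).
  have esym : connect_sym e.
    by apply: sym_connect_sym => x y; rewrite /e orbC.
  have adj (l : 'I_k.+1) : a <= l <= b -> connect e (v l) (v (ordS l)).
    move=> lab; apply: connect1; rewrite /e; move: lab; rewrite -run_edge.
    by case: (edge_vertices l) => -[-> _] ->; rewrite ?orbT.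
  have toa (l : 'I_k.+1) : a <= l <= b -> connect e (v a) (v l).
    have [m mE] : exists m, m = l - a by exists (l - a).
    elim: m l mE => [|m IH] l mE lab.
      by have -> : l = a by apply: val_inj => /=; lia.
    have l0 : l.-1 < k.+1 by have := ltn_ord l; lia.
    have -> : l = ordS (Ordinal l0).
      by apply: val_inj; rewrite /= modn_small; have := ltn_ord l; lia.
    by apply: connect_trans (IH (Ordinal l0) _ _) (adj (Ordinal l0) _) => /=; lia.
  have all x : x \in (run a b).1 -> connect e (v a) x.
    rewrite inE => /existsP [l /andP[lab /orP[]/eqP ->]]; first exact: toa.
    exact: connect_trans (toa l lab) (adj l lab).
  apply/forallP => x; apply/implyP => xr; apply/forallP => y; apply/implyP => yr.
  by apply: connect_trans (all y yr); rewrite esym all.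
- have ordS_inj : injective (@ordS k.+1) := can_inj (@ordSK _).
  have v_inj := bij_inj v_bij.
  (* Edges of equal direction sharing a head or a tail have the same index, hence the same other
     end. *)
  apply/forallP => x; apply/forallP => y; apply/forallP => z; apply/implyP => xz.
  apply/andP; split; apply: contraNN xz;
    move=> /andP[/imsetP [l +] + /imsetP [l']]; rewrite !inE => /dl dl1 + /dl dl2;
    rewrite /cycle_arc dl1 dl2; case: (d a) => -[-> ->] [].
  + by move=> -> /v_inj /ordS_inj ->.
  + by move=> -> /v_inj ->.
  + by move=> /v_inj -> ->.
  + by move=> /v_inj /ordS_inj -> ->.
Qed.

Lemma cand_incident H x i : block_cand H -> E i \in H.2 -> x \in H.1 ->
  exists2 l, E l \in H.2 & x = v l \/ x = v (ordS l).
Proof.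
move=> cH iH xH; have /andP[vi vi'] := cand_vertices cH iH.
have [->|xvi] := eqVneq x (v i); first by exists i => //; left.
have /and3P[_ /andP[_ /forallP conn] _] := cH.
have /forallP /(_ (v i)) := implyP (conn x) xH; rewrite vi /=.
move=> /connectP [[|y p] /= pth lst]; first by rewrite lst eqxx in xvi.
have {pth} /andP[xy _] := pth.
have [l lH xl] : exists2 l, E l \in H.2 & E l = (x, y) \/ E l = (y, x).
  by case/orP: xy => xy; have [l El] := cand_edge cH xy; exists l; rewrite El //; [left|right].
exists l => //; move: xl; case: (edge_vertices l) => -[-> _] [[]|[]]; auto.
Qed.

Lemma cand_sub_run H (a b : 'I_k.+1) i : block_cand H -> E i \in H.2 ->
  (forall l, E l \in H.2 -> a <= l <= b) ->
  (H.1 \subset (run a b).1) && (H.2 \subset (run a b).2).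
Proof.
move=> cH iH Hab; apply/andP; split; apply/subsetP => x xH.
  have [l lH xl] := cand_incident cH iH xH; have [vl vl'] := run_vertex (Hab l lH).
  by case: xl => ->.
by have [l El] := cand_edge cH xH; rewrite -El run_edge; apply: Hab; rewrite El.
Qed.

Lemma cand_no_edge H (l a b : 'I_k.+1) : block_cand H -> H.2 = set0 -> v l \in H.1 -> a <= l <= b ->
  (H.1 \subset (run a b).1) && (H.2 \subset (run a b).2).
Proof.
move=> cH H0 lH lab; rewrite H0 sub0set andbT; apply/subsetP => x xH.
have /and3P[_ /andP[_ /forallP conn] _] := cH.
have /forallP /(_ x) := implyP (conn (v l)) lH; rewrite xH /=.
move=> /connectP [[|y p] /= pth lst]; first by rewrite lst; have [] := run_vertex lab.
by move: pth; rewrite H0 !inE.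
Qed.

Lemma block_eq H K : H \in blocks C -> block_cand K ->
  (H.1 \subset K.1) && (H.2 \subset K.2) -> H = K.
Proof.
rewrite inE => /andP[_ /forallP mx] cK /andP[s1 s2].
by have := mx K; rewrite cK s1 s2 => /eqP ->.
Qed.

Lemma blocks_const : (forall i, d i = d ord0) -> #|blocks C| <= 1.
Proof.
move=> dc; have le (l : 'I_k.+1) : ord0 <= l <= (ord_max : 'I_k.+1) by rewrite leq0n -ltnS ltn_ord.
have cR : block_cand (run ord0 ord_max) by apply: run_cand => // l _; exact: dc.
rewrite -(cards1 (run ord0 ord_max)); apply: subset_leq_card; apply/subsetP => B bB.
rewrite inE; apply/eqP; apply: (block_eq bB cR).
have cB : block_cand B by move: bB; rewrite inE => /andP[].
have [B0|[x xB]] := set_0Vmem B.2.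
  have /and3P[_ /andP[/set0Pn [y yB] _] _] := cB; have [v' _ v'K] := v_bij.
  by apply: (@cand_no_edge B (v' y)) => //; rewrite v'K.
have [i Ei] := cand_edge cB xB; apply: (cand_sub_run (i := i)) => //.
by rewrite Ei.
Qed.

Lemma run_length (a b : 'I_k.+1) : a <= b -> (2 <= block_length (run a b)) = (a < b).
Proof.
move=> ab; rewrite /block_length card_imset //.
have [lt|ge] := ltnP a b.
  have <- : #|[set a; b]| = 2 by rewrite cards2 -val_eqE neq_ltn lt.
  by apply: subset_leq_card; apply/subsetP => l; rewrite !inE => /orP[]/eqP ->; rewrite ?leqnn ?ab.
apply/negbTE; rewrite -ltnNge ltnS -(cards1 a); apply: subset_leq_card.
by apply/subsetP => l; rewrite !inE -val_eqE /= => ?; lia.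
Qed.

(** All edges of a candidate have one direction by [cand_two_edges], so it lies in one of the two
    runs. The runs are incomparable, hence both are maximal. *)
Lemma blocks_two_runs (p q : 'I_k.+1) : val q = p.+1 ->
  (forall i : 'I_k.+1, d i = (i <= p)) ->
  blocks C = [set run ord0 p; run q ord_max] /\ run ord0 p != run q ord_max.
Proof.
move=> qE dE; have lem (l : 'I_k.+1) : l <= (ord_max : 'I_k.+1) by rewrite -ltnS ltn_ord.
have c1 : block_cand (run ord0 p) by apply: run_cand => // l /andP[_ lp]; rewrite !dE lp.
have c2 : block_cand (run q ord_max).
  have dF (r : 'I_k.+1) : q <= r -> d r = false by move: qE => /= qE qr; rewrite dE; lia.
  by apply: run_cand => // l /andP[ql _]; rewrite !dF.
have cov H : block_cand H -> (H.1 \subset (run ord0 p).1) && (H.2 \subset (run ord0 p).2) \/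
    (H.1 \subset (run q ord_max).1) && (H.2 \subset (run q ord_max).2).
  move=> cH; have [H0|[x xH]] := set_0Vmem H.2.
    have /and3P[_ /andP[/set0Pn [y yH] _] _] := cH; have [v' _ v'K] := v_bij.
    have [le|lt] := leqP (v' y) p; [left|right]; apply: (@cand_no_edge H (v' y)) => //;
      by rewrite ?v'K // qE lt lem.
  have [i Ei] := cand_edge cH xH; rewrite -{x}Ei in xH.
  have same (r : 'I_k.+1) : E r \in H.2 -> d r = d i.
    move=> rH; have [lt|lt|/val_inj ->//] := ltngtP r i.
    - have [/(_ i)|/(_ i)] := cand_two_edges cH lt rH xH => ->//;
      by rewrite leqnn ?orbT ?(ltnW lt).
    - have [/(_ r)|/(_ r)] := cand_two_edges cH lt xH rH => ->//;
      by rewrite leqnn ?orbT ?(ltnW lt).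
  have [le|lt] := leqP i p; [left|right]; apply: (cand_sub_run (i := i)) => // r /same;
    rewrite !dE; first by rewrite le.
  by rewrite (leqNgt i) lt /= lem qE => /negbT; rewrite -ltnNge => ->.
have ne (a b a' b' r : 'I_k.+1) : a <= r <= b -> ~~ (a' <= r <= b') ->
    ~ (run a b).2 \subset (run a' b').2.
  by move=> rab /negP nr /subsetP /(_ (E r)); rewrite !run_edge => /(_ rab).
have n12 : ~ (run ord0 p).2 \subset (run q ord_max).2.
  by apply: (ne _ _ _ _ p); rewrite ?leqnn // qE ltnn.
have n21 : ~ (run q ord_max).2 \subset (run ord0 p).2.
  by apply: (ne _ _ _ _ q); rewrite ?leqnn ?lem // qE ltnn.
split; last by apply/eqP => RE; apply: n12; rewrite RE.
apply/setP => B; rewrite !inE; apply/idP/idP.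
  move=> bB; have cB : block_cand B by case/andP: bB.
  have bB' : B \in blocks C by rewrite inE.
  by case: (cov B cB) => [/(block_eq bB' c1)|/(block_eq bB' c2)] ->; rewrite eqxx ?orbT.
case/orP => /eqP ->; rewrite /is_block ?c1 ?c2 /=; apply/forallP => K;
    apply/implyP => /and3P[cK s1 s2].
- case: (cov K cK) => /andP[t1 t2]; last by case: n12; apply: subset_trans t2.
  rewrite (surjective_pairing K); apply/eqP; congr (_, _); apply/eqP;
    by rewrite eqEsubset ?s1 ?s2 ?t1 ?t2.
- case: (cov K cK) => /andP[t1 t2]; first by case: n21; apply: subset_trans t2.
  rewrite (surjective_pairing K); apply/eqP; congr (_, _); apply/eqP;
    by rewrite eqEsubset ?s1 ?s2 ?t1 ?t2.
Qed.

Lemma two_runs_condition (p q : 'I_k.+1) : val q = p.+1 ->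
  (forall i : 'I_k.+1, d i = (i <= p)) ->
  (3 <= #|blocks C| \/
   (#|blocks C| = 2 /\ forall B, B \in blocks C -> 2 <= block_length B)) <->
  (0 < p /\ q < k).
Proof.
move=> qE dE; have [-> ne] := blocks_two_runs qE dE; rewrite cards2 ne.
have l1 : (2 <= block_length (run ord0 p)) = (0 < p) by rewrite run_length.
have l2 : (2 <= block_length (run q ord_max)) = (q < k).
  by rewrite run_length //= -ltnS.
split=> [[//|[_ H]]|[p0 qk]].
  by rewrite -l1 -l2; split; apply: H; rewrite !inE eqxx ?orbT.
by right; split=> // B; rewrite !inE => /orP[]/eqP ->; rewrite ?l1 ?l2.
Qed.

End CycleBlocks.

(** * Rotation of a cycle to a normal form *)

Lemma ordS_inj k : injective (@ordS k.+1).
Proof. exact: can_inj (@ordSK _). Qed.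

Lemma val_iter_ordS k (i : 'I_k.+1) m : val (iter m (@ordS k.+1) i) = (i + m) %% k.+1.
Proof.
elim: m => [|m IH]; first by rewrite addn0 modn_small.
by rewrite iterS -[LHS]/((val (iter m (@ordS k.+1) i)).+1 %% k.+1) IH -addn1 modnDml addn1 addnS.
Qed.

Lemma iter_ordS_reach k (i j : 'I_k.+1) : exists m, iter m (@ordS k.+1) i = j.
Proof.
exists (j + (k.+1 - i)); apply: val_inj; rewrite val_iter_ordS.
have -> : i + (j + (k.+1 - i)) = j + k.+1 by have := ltn_ord i; lia.
by rewrite modnDr modn_small.
Qed.

Lemma iter_ordS_bij k m : bijective (iter m (@ordS k.+1)).
Proof.
apply: injF_bij; elim: m => [|m IH] // x y; rewrite !iterS => /ordS_inj; exact: IH.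
Qed.

Lemma ordS_ord_max k : ordS (ord_max : 'I_k.+1) = ord0.
Proof. by apply: val_inj; rewrite /= modnn. Qed.

Definition cyclic_form k (C : digraph) (v : 'I_k -> C) (d : 'I_k -> bool) : Prop :=
  [/\ bijective v, injective (cycle_arc v d) &
      forall x y : C, arc x y <-> exists i, cycle_arc v d i = (x, y)].

Lemma cyclic_form_shift k (C : digraph) (v : 'I_k.+1 -> C) d m : cyclic_form v d ->
  cyclic_form (fun i => v (iter m (@ordS k.+1) i)) (fun i => d (iter m (@ordS k.+1) i)).
Proof.
move=> [v_bij e_inj eP]; have s_bij := iter_ordS_bij k m.
have E i : cycle_arc (fun i => v (iter m (@ordS k.+1) i))
    (fun i => d (iter m (@ordS k.+1) i)) i = cycle_arc v d (iter m (@ordS k.+1) i).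
  by rewrite /cycle_arc -iterSr iterS.
split; first exact: bij_comp v_bij s_bij.
- by move=> i j; rewrite !E => /e_inj; apply: bij_inj.
- move=> x y; rewrite eP; split=> -[i ii]; last by exists (iter m (@ordS k.+1) i); rewrite -E.
  by have [s' _ s'K] := s_bij; exists (s' i); rewrite E s'K.
Qed.

(** If [d] is not constant, some backward edge is followed by a forward one, and the rotation makes
    the latter edge 0. *)
Lemma cyclic_form_normal k (C : digraph) : cycle_orientation k.+1 C ->
  exists (v : 'I_k.+1 -> C) d, cyclic_form v d /\
    ((forall i, d i = d ord0) \/ (d ord0 /\ ~~ d ord_max)).
Proof.
move=> [v [d vd]].
have [/forallP const|] := boolP [forall i, d i == d ord0].
  by exists v, d; split=> //; left=> i; apply/eqP.
have [/existsP [i /andP[di di']]|none] := boolP [exists i, ~~ d i && d (ordS i)].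
  have [m mE] := iter_ordS_reach ord0 (ordS i) => _.
  exists (fun i => v (iter m (@ordS k.+1) i)), (fun i => d (iter m (@ordS k.+1) i)).
  split; first exact: cyclic_form_shift.
  right; rewrite mE; split=> //.
  have -> // : iter m (@ordS k.+1) ord_max = i.
  by apply: ordS_inj; rewrite -iterS iterSr ordS_ord_max.
rewrite negb_forall => /existsP [i di].
have prop (a b : 'I_k.+1) : ~~ d a -> ~~ d b.
  move=> da; have [m <-] := iter_ordS_reach a b; elim: m => // m IH; rewrite iterS.
  by apply/negP => dS; move/existsP: none => []; exists (iter m (@ordS k.+1) a); rewrite IH dS.
case d0: (d ord0) di; case d1: (d i) => // _.
- by have := prop i ord0; rewrite d0 d1 => /(_ isT).
- by have := prop ord0 i; rewrite d0 d1 => /(_ isT).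
Qed.

(** * From cycles to words and directed walks *)

Section Words.
Variables (k : nat) (C D : digraph) (v : 'I_k.+1 -> C) (d : 'I_k.+1 -> bool).
Hypothesis vd : cyclic_form v d.
Local Notation w := (mkseq (fun i => d (inord i)) k.+1).

Lemma has_cycle_contains : has_cycle (@arc D) w -> contains D C.
Proof.
have [v_bij _ eP] := vd; have [v' vK v'K] := v_bij.
move=> [x [p [/(walk_nthP x) []]]]; rewrite size_mkseq size_rcons => -[sz] st U.
pose h (i : 'I_k.+1) := nth x (x :: p) i.
have hS (i : 'I_k.+1) : nth x (x :: rcons p x) i.+1 = h (ordS i).
  rewrite /h /= nth_rcons sz; have [lt|ge] := ltnP i k.
    by rewrite modn_small.
  have -> : val i = k by have := ltn_ord i; rewrite ltnS /=; lia.
  by rewrite eqxx modnn.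
have h0 (i : 'I_k.+1) : nth x (x :: rcons p x) i = h i.
  rewrite /h; case: (val i) (ltn_ord i) => //= j jk; rewrite nth_rcons sz.
  by have -> : j < k by lia.
exists (h \o v') => [a b /= /eqP|a b /eP [i]].
  rewrite nth_uniq //= ?sz ?ltn_ord // => /eqP /val_inj /(congr1 v); by rewrite !v'K.
have := st i (ltn_ord i); rewrite nth_mkseq // inord_val hS h0 /step /cycle_arc.
by case: (d i) => ar [<- <-] /=; rewrite !vK.
Qed.

Lemma contains_hom : contains D C ->
  exists h : 'I_k.+1 -> D, forall i, step (@arc D) (d i) (h i) (h (ordS i)).
Proof.
have [_ _ eP] := vd; move=> [f _ fP]; exists (f \o v) => i.
rewrite /step /=; case di: (d i); apply: fP; apply/eP; exists i;
  by rewrite /cycle_arc di.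
Qed.
End Words.

Lemma dwalk_rcons (T : Type) (e : rel T) j x y z :
  dwalk e j x y -> e y z -> dwalk e j.+1 x z.
Proof.
elim: j x => [|j IH] x /=; first by move=> -> yz; exists z.
by move=> [u xu uy] yz; exists u => //; apply: IH.
Qed.

Lemma hom_dwalk (T : Type) (e : rel T) k (h : 'I_k.+1 -> T) d i m b :
  (forall i, step e (d i) (h i) (h (ordS i))) ->
  (forall j, j < m -> d (iter j (@ordS k.+1) i) = b) ->
  if b then dwalk e m (h i) (h (iter m (@ordS k.+1) i))
  else dwalk e m (h (iter m (@ordS k.+1) i)) (h i).
Proof.
move=> st; elim: m => [|m IH] run; first by case: b {run}.
have {}IH := IH (fun j jm => run j (ltnW jm)).
have := st (iter m (@ordS k.+1) i); rewrite run //.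
case: b IH {run} => wk ar; first exact: dwalk_rcons ar.
by exists (h (iter m (@ordS k.+1) i)).
Qed.

Lemma not_contains_const k (C D : digraph) (v : 'I_k.+1 -> C) d : cyclic_form v d ->
  (forall i, d i = d ord0) -> (forall x : D, ~ dwalk (@arc D) k.+1 x x) -> ~ contains D C.
Proof.
move=> vd dc nw /(contains_hom vd) [h hP].
have := hom_dwalk (i := ord0) (m := k.+1) hP (fun j _ => dc _).
have -> : iter k.+1 (@ordS k.+1) ord0 = ord0 by apply: val_inj; rewrite val_iter_ordS modnn.
by case: (d ord0) => /nw.
Qed.

(** A block of length one makes the cycle an arc parallel to a directed path of length [k]. That arc
    comes from edge 0 if [p] is 0, and from the last edge otherwise. *)
Lemma not_contains_chord k (C D : digraph) (v : 'I_k.+1 -> C) d (p : 'I_k.+1) :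
  cyclic_form v d -> p < k -> (forall i : 'I_k.+1, d i = (i <= p)) ->
  ~ (0 < p /\ p.+1 < k) ->
  (forall x y : D, arc x y -> ~ dwalk (@arc D) k x y) -> ~ contains D C.
Proof.
move=> vd pk dE npq nw /(contains_hom vd) [h hP].
have [p0|p0] := posnP p.
  have st0 := hP ord0; rewrite dE /= in st0; apply: (nw _ _ st0).
  have /= := hom_dwalk (i := ordS ord0) (m := k) (b := false) hP.
  have -> : iter k (@ordS k.+1) (ordS ord0) = ord0.
    by rewrite -iterSr; apply: val_inj; rewrite val_iter_ordS modnn.
  apply=> j jk; rewrite dE p0 -iterSr val_iter_ordS add0n modn_small //; lia.
have st0 := hP ord_max; rewrite ordS_ord_max dE /= leqNgt pk /= in st0; apply: (nw _ _ st0).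
have /= := hom_dwalk (i := ord0) (m := k) (b := true) hP.
have -> : iter k (@ordS k.+1) ord0 = ord_max.
  by apply: val_inj; rewrite val_iter_ordS add0n modn_small.
apply=> j jk; rewrite dE val_iter_ordS add0n modn_small //; lia.
Qed.

(** * Patterns in words *)

(** The opposite defaults of [nth] force both [i] and [j] to be positions inside [s]. *)
Lemma ascent_descent (s : seq bool) i j : i < j -> nth false s i -> ~~ nth true s j ->
  exists s1 s2, s = s1 ++ [:: true; false] ++ s2.
Proof.
elim: s i j => [|a s IH] i j; first by rewrite !nth_nil.
case: i => [|i] /=; last first.
  case: j => // j ij si sj; have [s1 [s2 ->]] := IH i j ij si sj.
  by exists (a :: s1), s2.
case: j => // j _ aT sj; case: s IH sj => [|[] s] IH sj; first by case: j sj.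
  case: j sj => // j sj; have [s1 [s2 ->]] := IH 0 j.+1 isT isT sj.
  by exists (a :: s1), s2.
by exists [::], s; rewrite aT.
Qed.

(** One descent is found in the prefix of length [i.+1] and one in the remaining suffix, so the two
    do not overlap. *)
Lemma word_two_sinks (s : seq bool) i j : 0 < i -> i < j -> j < (size s).-1 ->
  nth false s 0 -> ~~ nth true s i -> nth false s j -> ~~ last true s ->
  exists s1 s2 s3, s = s1 ++ [:: true; false] ++ s2 ++ [:: true; false] ++ s3.
Proof.
move=> i0 ij js s0 si sj sl.
have [s1 [s2 E1]] : exists s1 s2, take i.+1 s = s1 ++ [:: true; false] ++ s2.
  by apply: (ascent_descent i0); rewrite nth_take.
have [s3 [s4 E2]] : exists s1 s2, drop i.+1 s = s1 ++ [:: true; false] ++ s2.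
  apply: (@ascent_descent _ (j - i.+1) ((size s).-1 - i.+1)); first lia.
    by rewrite nth_drop subnKC.
  by rewrite nth_drop subnKC ?nth_last //; lia.
exists s1, (s2 ++ s3), s4; rewrite -[LHS](cat_take_drop i.+1) E1 E2.
by rewrite -!catA.
Qed.

Lemma mkseq_threshold p n : p <= n ->
  mkseq (fun i => i < p) n = nseq p true ++ nseq (n - p) false.
Proof.
move=> pn; apply: (@eq_from_nth _ false); first by rewrite size_mkseq size_cat !size_nseq; lia.
move=> i; rewrite size_mkseq => ik.
rewrite nth_mkseq // nth_cat size_nseq !nth_nseq; case: ltnP => //.
by case: ifP.
Qed.

(** * Minimum out-degree, real constants and the equivalence *)

Lemma min_outdeg_le (D : digraph) (x : D) : min_outdeg D <= outdeg x.
Proof.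
rewrite /min_outdeg; have := mem_index_enum x.
elim: (index_enum _) => // y r IH; rewrite inE big_cons => /orP[/eqP <-|/IH le].
  exact: geq_minl.
exact: leq_trans (geq_minr _ _) le.
Qed.

(** The default value [#|D|] of the minimum satisfies the bound because [0 < M]. *)
Lemma card_le_min_outdeg (D : digraph) (M : nat) : 0 < M ->
  (forall x : D, #|D| <= M * outdeg x) -> #|D| <= M * min_outdeg D.
Proof.
move=> M0 H; rewrite /min_outdeg; elim/big_ind: _ => //; first exact: leq_pmull.
by move=> a b; rewrite /minn; case: ifP.
Qed.

Lemma chi_le_card (D : digraph) : chi D <= #|D|.
Proof.
apply/chi_le; exists (fun x => val (enum_rank x)); split=> [x _|x y _ _]; first exact: ltn_ord.
apply: contraTneq => /val_inj /enum_rank_inj ->; by rewrite arc_irr.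
Qed.

Import Order.TTheory GRing.Theory Num.Theory.
Local Open Scope ring_scope.

Definition forced (R : realType) (C : digraph) : Prop :=
  forall eps : R, 0 < eps ->
     exists2 c : R, 1 <= c &
       forall D : digraph,
         c <= (chi D)%:R ->
         eps * #|D|%:R <= (min_outdeg D)%:R ->
         contains D C.

Lemma forced_of_word (R : realType) (C : digraph) (w : seq bool) :
  (forall D : digraph, has_cycle (@arc D) w -> contains D C) ->
  (exists w1 w2, w = w1 ++ [:: true; false] ++ w2 ++ [:: true; false]) \/
  (exists w1, w = w1 ++ [:: true; true; false; false]) ->
  forced R C.
Proof.
move=> wC good eps eps0.
have eV : 0 <= eps^-1 by rewrite invr_ge0 ltW.
pose s := Num.bound eps^-1; have [c0 c0P] := cycle_of_large_chi s good.
(* Since [chi D <= #|D|], this bound also provides [c0 < #|D|]. *)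
exists c0.+1%:R => [|D]; first by rewrite ler1n.
rewrite ler_nat => cD deg; apply/wC/c0P.
- exact: arc_irr.
- move=> x; apply: (@leq_trans (s * min_outdeg D)); last first.
    by rewrite leq_mul2l min_outdeg_le orbT.
  rewrite -(ler_nat R) natrM; apply: le_trans (ler_wpM2l (ler0n _ s) deg).
  rewrite mulrA ler_peMl // -ler_pdivrMr // mul1r.
  exact/ltW/archi_boundP.
- exact: leq_trans (chi_le_card D).
- by move/chi_le; rewrite leqNgt cD.
Qed.

Lemma not_forced (R : realType) (C : digraph) (k : nat) : (1 < k)%N ->
  (forall D : digraph, (forall x : D, ~ dwalk (@arc D) k x x) ->
     ((2 < k)%N -> forall x y : D, arc x y -> ~ dwalk (@arc D) k.-1 x y) ->
     ~ contains D C) ->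
  ~ forced R C.
Proof.
(* This out-degree density is attained by [sparse_digraph] for every bound on the chromatic
   number. *)
move=> k2 avoid /(_ (4 * k.+2)%:R^-1) [|c c1 cP].
  by rewrite invr_gt0 ltr0n muln_gt0.
have [D [chiD degD nocyc nochord]] := sparse_digraph (Num.bound c) k2.
apply: (avoid D nocyc nochord); apply: cP.
  apply/ltW/(lt_trans (archi_boundP _)); first exact: le_trans ler01 c1.
  by rewrite ltr_nat.
rewrite mulrC ler_pdivrMr ?ltr0n ?muln_gt0 // -natrM ler_nat mulnC.
by apply: card_le_min_outdeg; rewrite ?muln_gt0.
Qed.

Theorem theorem1p3 (R : realType) (k : nat) (hk : (2 <= k)%N) (C : digraph)
    (hC : cycle_orientation k C) :
  (forall eps : R, 0 < eps ->
     exists2 c : R, 1 <= c &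
       forall D : digraph,
         c <= (chi D)%:R ->
         eps * #|D|%:R <= (min_outdeg D)%:R ->
         contains D C)
  <->
  ((3 <= #|blocks C|)%N \/
   (#|blocks C| = 2%N /\ forall B, B \in blocks C -> (2 <= block_length B)%N)).
Proof.
(* From here on the cycle has [k.+1] edges, indexed from 0 to [k]. *)
rewrite -/(forced R C); case: k hk hC => // k k1 /cyclic_form_normal [v [d [vd ends]]].
have [v_bij e_inj eP] := vd.
have [const|not_const] := pselect (forall i, d i = d ord0).
  have b1 := blocks_const v_bij e_inj eP const.
  split=> [frc|[b3|[b2 _]]]; [|by move: (leq_trans b3 b1)|by rewrite b2 in b1].
  case: (not_forced k1 _ frc) => D nocyc _.
  exact: not_contains_const vd const nocyc.
have [d0 dm] : d ord0 /\ ~~ d ord_max by case: ends => [/not_const|].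
(* [q] is the first backward edge. Either all edges from [q] on are backward, giving two blocks, or
   a later forward edge [i] makes the directions alternate at 0, [q], [i], [k]. *)
have [q dq qmin] : exists2 q : 'I_k.+1, ~~ d q & forall i : 'I_k.+1, (i < q)%N -> d i.
  have Pm : (fun i : 'I_k.+1 => ~~ d i) ord_max := dm.
  case: (@arg_minnP _ ord_max (fun i : 'I_k.+1 => ~~ d i) (fun i => i : nat) Pm) => q dq qmin.
  by exists q => // i iq; apply: contraT => /qmin; rewrite leqNgt iq.
have q0 : (0 < q)%N.
  by rewrite lt0n; apply: contraNneq dq => q0; have -> : q = ord0 by apply: val_inj.
pose w := mkseq (fun i => d (inord i)) k.+1.
have wC D : has_cycle (@arc D) w -> contains D C := @has_cycle_contains _ C D v d vd.
have [two|more] := pselect (forall i : 'I_k.+1, d i = (i < q)%N).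
  pose p : 'I_k.+1 := inord q.-1.
  have pE : (p : nat) = q.-1 by rewrite inordK //; have := ltn_ord q; lia.
  have qp : (q : nat) = p.+1 by rewrite pE prednK.
  have dE (i : 'I_k.+1) : d i = (i <= p)%N by rewrite two qp ltnS.
  have cond := two_runs_condition v_bij e_inj eP qp dE.
  have pk : (p < k)%N by have := ltn_ord q; rewrite qp.
  split=> [frc|/cond [p0 qk]].
    apply/cond; apply: contrapT => npq; case: (not_forced k1 _ frc) => D _ nochord.
    (* In a 2-cycle, one forward and one backward edge would yield the same arc, against
       injectivity. *)
    have k2 : (2 < k.+1)%N.
      rewrite ltnS ltnNge; apply/negP => k1'.
      have k1E : k = 1%N by apply/eqP; rewrite eqn_leq k1' -ltnS.
      have := @e_inj ord0 ord_max; rewrite /cycle_arc d0 (negPf dm) ordS_ord_max.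
      have -> : ordS (ord0 : 'I_k.+1) = ord_max.
        by apply: val_inj; rewrite /= modn_small k1E.
      by move=> /(_ erefl) /(congr1 val) /= k0; rewrite -k0 in k1E.
    apply: (not_contains_chord vd pk dE) (nochord k2).
    by rewrite -qp.
  (* The word has [q] letters [true], then [k.+1 - q] letters [false]. Moving all but two of the
     latter to the front leaves the pattern [UUDD] at the end. *)
  apply: (@forced_of_word R C ((nseq (k - q.+1) false ++ nseq q.-1.-1 true) ++ [:: true; true; false; false])); last by right; eexists.
  move=> D; rewrite -catA => /has_cycle_rot hc; apply: wC.
  suff -> : w = (nseq q.-2 true ++ [:: true; true; false; false]) ++ nseq (k - q.+1) false.
    by [].
  have -> : w = mkseq (fun i => i < q)%N k.+1.
    apply: (@eq_from_nth _ false) => [|i]; rewrite !size_mkseq // => ik.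
    by rewrite !nth_mkseq // two inordK.
  rewrite mkseq_threshold; last exact: ltnW.
  have -> : (k.+1 - q = 2 + (k - q.+1))%N by lia.
  rewrite -[X in nseq X true](@subnK 2) ?qp // subn2 nseqD /= -!catA //.
have [i [iq di]] : exists i : 'I_k.+1, (q <= i)%N /\ d i.
  move/existsNP: more => [i di]; exists i; have [iq|qi] := ltnP i q.
    by case: di; rewrite iq qmin.
  by split=> //; apply: contraT => /negPf di'; case: di; rewrite di' ltnNge qi.
have {}iq : (q < i)%N.
  by rewrite ltn_neqAle iq andbT; apply: contraNneq dq => /val_inj ->.
have ik : (i < k)%N.
  have : (i <= k)%N := leq_ord i.
  rewrite leq_eqVlt => /orP[/eqP ik|//].
  by move: dm; have -> : ord_max = i by [apply: val_inj; rewrite /= ik]; rewrite di.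
have nth_w b (j : 'I_k.+1) : nth b w j = d j by rewrite nth_mkseq // inord_val.
(* Both sides of the equivalence hold: the alternation gives three blocks and also two disjoint
   descents in [w]. *)
split=> _; first by left; apply: (three_blocks v_bij e_inj eP q0 iq ik).
have [|||||s1 [s2 [s3 wE]]] := @word_two_sinks w q i q0 iq.
- by rewrite size_mkseq.
- by rewrite (nth_w _ ord0).
- by rewrite nth_w.
- by rewrite nth_w.
- by rewrite -nth_last size_mkseq (nth_w _ ord_max).
apply: (@forced_of_word R C ((s3 ++ s1) ++ [:: true; false] ++ s2 ++ [:: true; false])).
  by move=> D; rewrite -catA => /has_cycle_rot hc; apply: wC; rewrite wE; move: hc; rewrite -!catA.
by left; exists (s3 ++ s1), s2.
Qed.
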